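(* Let $\mathbb{F}$ be an algebraically closed field, $G$ an abelian group and $m,n\ge 1$. Every odd $G$-grading on the associative superalgebra $M(m,n)$ is isomorphic to some $\Gamma(T,\beta,\gamma)$. Two odd gradings, $\Gamma(T,\beta,\gamma)$ and $\Gamma(T',\beta',\gamma')$, on $M(m,n)$ are isomorphic if, and only if, $T=T'$, $\beta=\beta'$, and there is $g\in G$ such that $g\,\Xi(\gamma)=\Xi(\gamma')$.
   Context: $M(m,n)$ is the associative superalgebra $M_{m+n}(\mathbb{F})=\mathrm{End}(\mathbb{F}^m\oplus\mathbb{F}^n)$ whose even part consists of the block-diagonal matrices and whose odd part consists of the block-off-diagonal matrices (diagonal blocks of sizes $m$ and $n$). A $G$-grading on a superalgebra $A=A^{\bar 0}\oplus A^{\bar 1}$ is a decomposition $A=\bigoplus_{g\in G}A_g$ with $A_gA_h\subseteq A_{gh}$ and $A_g=(A_g\cap A^{\bar 0})\oplus(A_g\cap A^{\bar 1})$. Two $G$-gradings $A=\bigoplus A_g$ and $A=\bigoplus A'_g$ are isomorphic if some automorphism $\varphi$ of the superalgebra $A$ satisfies $\varphi(A_g)=A'_g$ for all $g$. Graded division algebras. A graded division algebra is a graded unital associative algebra in which every nonzero homogeneous element is invertible. For an abelian group $K$, if $D$ is a finite-dimensional $K$-graded division algebra that is simple as an algebra, then $T=\mathrm{supp}\,D$ is a finite subgroup of $K$, each $D_t$ ($t\in T$) is spanned by one element $X_t$, and $X_uX_v=\beta(u,v)X_vX_u$ defines a nondegenerate alternating bicharacter $\beta:T\times T\to\mathbb{F}^\times$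 (alternating: $\beta(t,t)=1$; nondegenerate: $\beta(t,T)=1$ only for $t=e$). Up to graded isomorphism $D$ is determined by $(T,\beta)$, and every such pair occurs. Even and odd gradings. Put $G^\#=G\times\mathbb{Z}_2$, let $p:G^\#\to\mathbb{Z}_2$ be the projection, and identify $G$ with $G\times\{\bar 0\}$. A $G$-grading on a superalgebra is the same as a $G^\#$-grading on the underlying algebra. For any $G$-grading on $M(m,n)$ there are a $G^\#$-graded division algebra $D$ and a $G^\#$-graded right $D$-module $\mathcal{U}$ of finite rank with $M(m,n)\cong\mathrm{End}_D(\mathcal{U})$ as $G^\#$-graded algebras. The grading is called even if $\mathrm{supp}\,D\subseteq G\times\{\bar 0\}$, and odd otherwise. The grading $\Gamma(T,\beta,\gamma)$. Let $T\subseteq G^\#$ be a finite subgroup not contained in $G$, $\beta$ a nondegenerate alternating bicharacter on $T$, $D$ the $G^\#$-graded division algebra associated to $(T,\beta)$ and $\gamma=(g_1,\dots,g_k)$ a $k$-tuple of elements of $G=G\times\{\bar 0\}$. The algebra $M_k(\mathbb{F})\otimes D$ is $G^\#$-graded by $\deg(E_{ij}\otimes d)=g_i(\deg d)g_j^{-1}$ (this is $\mathrm{End}_D(\mathcal{U})$ where $\mathcal{U}$ has a homogeneous $D$-basis of degrees $g_1,\dots,g_k$) and becomes a superalgebra via $p$. $\Gamma(T,\beta,\gamma)$ is the corresponding $G$-grading on $M(m,n)$, when $M(m,n)$ is isomorphic to this superalgebra (defined up to isomorphism of gradings by transport along such an isomorphism). Multisets. $\Xi(\gamma)$ is the multiset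 in $G^\#/T\cong G/(T\cap G)$ consisting of the cosets $g_1T,\dots,g_kT$ counted with multiplicity; $G$ acts on such multisets by multiplication. *)

(* Defs.v *)
From HB Require Import structures.
From mathcomp Require Import all_boot all_order all_algebra all_field.
From mathcomp Require Import finmap multiset.

Set Implicit Arguments.
Unset Strict Implicit.
Unset Printing Implicit Defensive.

Import GRing.Theory.
Local Open Scope ring_scope.

(* Abelian groups are written additively: G is a zmodType (possibly          *)
(* infinite), and G^# = G x Z_2; g in G is identified with (g, 0) in G^#.    *)
Notation Gsharp G := (G * 'Z_2)%type.

Definition inG {G : zmodType} (g : G) : Gsharp G := (g, 0).

Section Gradings.
Variable (F : fieldType) (K : zmodType).

(* The vector space is finite dimensional but K may be infinite: a family is *)
(* independent when all its finite subfamilies are, and it spans when        *)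
(* finitely many members already do.                                         *)
Definition direct_decomposition (V : vectType F) (VG : K -> {vspace V}) :=
  (forall s : seq K, uniq s -> directv (\sum_(g <- s) VG g)) /\
  (exists s : seq K, (\sum_(g <- s) VG g = fullv)%VS).

Definition is_grading (A : falgType F) (AG : K -> {vspace A}) : Prop :=
  direct_decomposition AG /\ forall g h, (AG g * AG h <= AG (g + h)%R)%VS.

Definition graded_division (D : falgType F) (DG : K -> {vspace D}) : Prop :=
  is_grading DG /\
  forall g x, x \in DG g -> x != 0 -> x \is a GRing.unit.

Definition simple_algebra (A : falgType F) : Prop :=
  forall I : {vspace A},
    (I * fullv <= I)%VS -> (fullv * I <= I)%VS -> I = 0%VS \/ I = fullv.

(* The right D-module U is given by its action [act d u] = u . d. As D has   *)
(* finite dimension over F, finite rank over D amounts to finite dimension   *)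
(* over F, hence the vectType.                                               *)
Record graded_rmodule (D : falgType F) (DG : K -> {vspace D})
    (U : vectType F) (UG : K -> {vspace U}) (act : 'Hom(D, 'End(U))) : Prop :=
  GradedRModule {
    ract1 : act 1 = \1%VF;
    ractM : forall x y : D, act (x * y) = (act y \o act x)%VF;
    rmod_decomp : direct_decomposition UG;
    ract_deg : forall g h u d,
      u \in UG g -> d \in DG h -> act d u \in UG (g + h)
  }.

(* F-linear maps suffice, since D-linear maps are F-linear.                  *)
Definition in_EndD (D : falgType F) (U : vectType F) (act : 'Hom(D, 'End(U)))
    (f : 'End(U)) : Prop :=
  forall d, (f \o act d = act d \o f)%VF.

Definition EndD_degree (U : vectType F) (UG : K -> {vspace U}) (g : K)
    (f : 'End(U)) : Prop :=
  forall h, (f @: UG h <= UG (g + h)%R)%VS.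

(* [rho] is an isomorphism of K-graded algebras from A onto End_D(U).        *)
Record graded_iso_EndD (A : falgType F) (AG : K -> {vspace A})
    (D : falgType F) (U : vectType F) (UG : K -> {vspace U})
    (act : 'Hom(D, 'End(U))) (rho : 'Hom(A, 'End(U))) : Prop :=
  GradedIsoEndD {
    EndD_inj : injective rho;
    EndD_mul : forall a b : A, rho (a * b) = (rho a \o rho b)%VF;
    EndD_img : forall f : 'End(U), in_EndD act f <-> exists a : A, f = rho a;
    EndD_grad : forall g (a : A), a \in AG g <-> EndD_degree UG g (rho a)
  }.

End Gradings.

Section Superalgebra.
Variable (F : fieldType) (m n : nat).

(* M(m+1, n+1): positive block sizes are written as successors.              *)
Notation Mmn := ('M[F]_(m.+1 + n.+1)).

Definition parity_part (p : 'Z_2) : {vspace Mmn} :=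
  if p == 0
  then (lker (linfun (rsubmx \o usubmx : Mmn -> 'M_(m.+1, n.+1)))
        :&: lker (linfun (lsubmx \o dsubmx : Mmn -> 'M_(n.+1, m.+1))))%VS
  else (lker (linfun (lsubmx \o usubmx : Mmn -> 'M_m.+1))
        :&: lker (linfun (rsubmx \o dsubmx : Mmn -> 'M_n.+1)))%VS.

Lemma mem_even_part (A : Mmn) :
  (A \in parity_part 0) = (ursubmx A == 0) && (dlsubmx A == 0).
Proof.
by rewrite /parity_part eqxx memv_cap !memv_ker !lfunE /= /ursubmx /dlsubmx.
Qed.

Lemma mem_odd_part (A : Mmn) :
  (A \in parity_part 1) = (ulsubmx A == 0) && (drsubmx A == 0).
Proof.
by rewrite /parity_part memv_cap !memv_ker !lfunE /= /ulsubmx /drsubmx.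
Qed.

Variable G : zmodType.

Definition super_grading (Gam : G -> {vspace Mmn}) : Prop :=
  is_grading Gam /\
  forall g, Gam g = (Gam g :&: parity_part 0%R + Gam g :&: parity_part 1%R)%VS.

Definition grading_iso (Gam Gam' : G -> {vspace Mmn}) : Prop :=
  exists phi : 'AEnd(Mmn),
    [/\ bijective phi,
        forall p, (phi @: parity_part p)%VS = parity_part p
      & forall g, (phi @: Gam g)%VS = Gam' g].

Definition sharp_grading (Gam : G -> {vspace Mmn}) (x : Gsharp G) :
    {vspace Mmn} :=
  (Gam x.1 :&: parity_part x.2)%VS.

Definition even_grading (Gam : G -> {vspace Mmn}) : Prop :=
  exists (D : falgType F) (DG : Gsharp G -> {vspace D})
         (U : vectType F) (UG : Gsharp G -> {vspace U})
         (act : 'Hom(D, 'End(U))) (rho : 'Hom(Mmn, 'End(U))),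
    [/\ graded_division DG,
        graded_rmodule DG UG act,
        graded_iso_EndD (sharp_grading Gam) UG act rho
      & forall x : Gsharp G, DG x != 0%VS -> x.2 = 0].

Definition odd_grading (Gam : G -> {vspace Mmn}) : Prop := ~ even_grading Gam.

End Superalgebra.

Section GammaGradings.
Variable (F : fieldType) (G : zmodType).

Definition is_subgroup (T : {fset Gsharp G}) : Prop :=
  0 \in T /\ {in T &, forall u v, u - v \in T}.

(* A function on T x T is encoded by a total function on G^# x G^# of which  *)
(* only the values on T x T matter.                                          *)
Record nondeg_alt_bicharacter (T : {fset Gsharp G})
    (beta : Gsharp G -> Gsharp G -> F) : Prop :=
  NondegAltBicharacter {
    bichar_neq0 : {in T &, forall u v, beta u v != 0};
    bicharDl : {in T & &, forall u v w, beta (u + v) w = beta u w * beta v w};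
    bicharDr : {in T & &, forall u v w, beta u (v + w) = beta u v * beta u w};
    bichar_alt : {in T, forall t, beta t t = 1};
    bichar_nondeg : {in T, forall t, {in T, forall u, beta t u = 1} -> t = 0}
  }.

Definition odd_datum (T : {fset Gsharp G}) (beta : Gsharp G -> Gsharp G -> F) :
    Prop :=
  [/\ is_subgroup T, exists2 t, t \in T & t.2 != 0
    & nondeg_alt_bicharacter T beta].

(* D is the G^#-graded division algebra associated to (T, beta), which is    *)
(* unique up to graded isomorphism.                                          *)
Record associated_division (T : {fset Gsharp G})
    (beta : Gsharp G -> Gsharp G -> F)
    (D : falgType F) (DG : Gsharp G -> {vspace D}) : Prop :=
  AssociatedDivision {
    assoc_division : graded_division DG;
    assoc_simple : simple_algebra D;
    assoc_supp : forall t, (DG t != 0%VS) = (t \in T);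
    assoc_dim : {in T, forall t, \dim (DG t) = 1%N};
    assoc_comm : {in T &, forall u v (x y : D),
      x \in DG u -> y \in DG v -> x * y = beta u v *: (y * x)}
  }.

(* M_k(F) (x) D is realized as 'M[D]_k, with E_ij (x) d the matrix having    *)
(* the single entry d at (i, j). Since E_ij (x) d has degree                 *)
(* g_i + deg d - g_j, B is homogeneous of degree x iff each entry B i j is   *)
(* homogeneous of degree x - g_i + g_j.                                      *)
Definition Mk_degree (D : falgType F) (DG : Gsharp G -> {vspace D}) (k : nat)
    (gam : k.-tuple G) (x : Gsharp G) (B : 'M[D]_k) : Prop :=
  forall i j, B i j \in DG (x - inG (tnth gam i) + inG (tnth gam j)).

(* Gam is the grading Gamma(T, beta, gamma) on M(m+1, n+1), i.e., the        *)
(* grading of M_k(F) (x) D transported along an isomorphism [psi], which is  *)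
(* F-linear as F acts on 'M[D]_k through the scalars c%:A of D. Matching the *)
(* G^#-gradings makes [psi] respect both the G-grading and the parity.       *)
Definition is_Gamma (m n : nat) (T : {fset Gsharp G})
    (beta : Gsharp G -> Gsharp G -> F) (k : nat) (gam : k.-tuple G)
    (Gam : G -> {vspace 'M[F]_(m.+1 + n.+1)}) : Prop :=
  super_grading Gam /\
  exists (D : falgType F) (DG : Gsharp G -> {vspace D}),
    associated_division T beta DG /\
    exists psi : {rmorphism 'M[F]_(m.+1 + n.+1) -> 'M[D]_k},
      [/\ bijective psi,
          forall (c : F) a, psi (c *: a) = (c%:A : D) *: psi a
        & forall x a, a \in sharp_grading Gam x <->
                      Mk_degree DG gam x (psi a)].

Definition translate (x : Gsharp G) (C : {fset Gsharp G}) : {fset Gsharp G} :=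
  [fset (x + c)%R | c in C]%fset.

(* The coset g + T is the finite set translate (g, 0) T.                     *)
Definition Xi (T : {fset Gsharp G}) (k : nat) (gam : k.-tuple G) :
    {mset {fset Gsharp G}}%mset :=
  seq_mset [seq translate (inG g) T | g <- gam].

Definition translate_mset (g : G) (M : {mset {fset Gsharp G}}%mset) :
    {mset {fset Gsharp G}}%mset :=
  seq_mset [seq translate (inG g) C | C <- enum_mset M].

End GammaGradings.

(* Main.v *)
Require Import Defs.
From HB Require Import structures.
From mathcomp Require Import all_boot all_order all_algebra all_field.
From mathcomp Require Import fingroup perm.
From mathcomp Require Import finmap multiset.
From Stdlib Require Import Classical.

(* A minimal graded left ideal of the simple algebra R = M(m,n), graded by   *)
(* G^#, is R e for an idempotent e of degree 0, and D = e R e is then a      *)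
(* graded division algebra. The identity of R splits as a sum of u_i v_i     *)
(* with u_i in R e, v_i in e R homogeneous of opposite degrees and           *)
(* v_i u_j = delta_ij e, whence r |-> (v_i r u_j) is an isomorphism from R   *)
(* onto M_k(D). As F is algebraically closed, the components of D are lines  *)
(* and its only central elements are scalars, which gives (T, beta). When T  *)
(* contains an odd element, multiplying the u_i of odd degree by it makes    *)
(* all degrees even.                                                         *)
(* Conversely, if e and e' come from two such descriptions of one grading,   *)
(* there are homogeneous a, b with a b = e and b a = e'. Conjugation by them *)
(* identifies e R e with e' R e', so (T, beta) is an invariant; right        *)
(* multiplication by a identifies R e with R e' up to a shift of degrees,    *)
(* and the dimensions of the components of R e count the elements of gamma   *)
(* in each coset of T.                                                       *)

(** Existence is assembled in [odd_grading_is_Gamma]. Brauer's lemma in graded form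
    ([primitive_homogeneous_idempotent]) gives e, splitting 1 ([idempotent_frame]) gives the u_i and
    v_i, [frame_matrix_iso] identifies R with M_k(D), and [graded_division_associated] reads (T,
    beta) off D. If T lay in G, then [frame_EndD] would present the grading as End_D(R e) with D
    supported in G, that is, as an even grading; so an odd grading provides an odd homogeneous unit
    of D.

    Equal invariants give isomorphic gradings because D is determined by (T, beta)
    ([associated_division_iso]), and because permuting indices and conjugating by a diagonal matrix
    of homogeneous units moves each g_i freely inside its coset of T ([matrix_regrading]).

    Conversely, an isomorphism allows both presentations to be read on one grading, where
    [is_Gamma_unique] compares their idempotents through [division_idempotent_link]. The resulting
    shift lies a priori only in G^#, but its coset meets G because T contains an odd element. *)

Set Implicit Arguments.
Unset Strict Implicit.
Unset Printing Implicit Defensive.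

Import GRing.Theory.
Local Open Scope ring_scope.

(** * Direct sums and homogeneous components *)

Section DirectSums.
Variables (F : fieldType) (V : vectType F).

Lemma sumv_seq_sup (I : eqType) (s : seq I) (VG : I -> {vspace V}) i :
  i \in s -> (VG i <= \sum_(j <- s) VG j)%VS.
Proof.
elim: s => //= j s IH; rewrite inE big_cons => /orP[/eqP<-|/IH le_i].
  exact: addvSl.
exact: subv_trans le_i (addvSr _ _).
Qed.

(** A vector common to one summand and to the sum of the others is both fixed and killed by the
    projection of that summand. *)
Lemma directv_of_projections (I : eqType) (s : seq I) (VG : I -> {vspace V})
    (pi : I -> 'End(V)) :
    uniq s ->
    (forall i j v, v \in VG j -> pi i v = if i == j then v else 0) ->
  directv (\sum_(i <- s) VG i).
Proof.
move=> + piE; rewrite directvE /=.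
elim: s => [|i s IH] /=; first by rewrite !big_nil dimv0.
case/andP=> nis us; rewrite !big_cons dimv_disjoint_sum ?(eqP (IH us)) //.
apply/eqP; rewrite -subv0; apply/subvP => v; rewrite memv_cap memv0.
case/andP=> vi vs; have <- : pi i v = v by rewrite (piE _ _ _ vi) eqxx.
rewrite -memv_ker; move: v vs {vi}; apply/subvP; rewrite big_seq.
elim/big_rec: _ => [|j W js IHW]; first by rewrite sub0v.
rewrite subv_add IHW andbT; apply/subvP=> v vj.
rewrite memv_ker (piE _ _ _ vj).
by case: (i =P j) js nis => [<- ->|_].
Qed.

(** Directness is an equality of dimensions; it forces the head summand to meet the sum of the tail
    trivially, and it passes to the tail. *)
Lemma directv_independent (I : eqType) (s : seq I) (VG : I -> {vspace V})
    (x : I -> V) :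
    uniq s -> directv (\sum_(i <- s) VG i) -> (forall i, x i \in VG i) ->
  \sum_(i <- s) x i = 0 -> forall i, i \in s -> x i = 0.
Proof.
rewrite directvE /= => us dir xV.
elim: s us dir => [|i s IH] //= /andP[_ us].
have le_dim : (\dim (\sum_(j <- s) VG j) <= \sum_(j <- s) \dim (VG j))%N.
  exact: dimv_leq_sum.
rewrite !big_cons => /eqP dimE sum0.
have cap := dimv_sum_cap (VG i) (\sum_(j <- s) VG j)%VS.
have le_dims : (\dim (VG i + \sum_(j <- s) VG j) <=
  \dim (VG i) + \dim (\sum_(j <- s) VG j))%N by rewrite -cap leq_addr.
have dims : \dim (\sum_(j <- s) VG j) = (\sum_(j <- s) \dim (VG j))%N.
  by apply/eqP; rewrite eqn_leq le_dim -(leq_add2l (\dim (VG i))) -dimE.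
have cap0 : (VG i :&: \sum_(j <- s) VG j)%VS = 0%VS.
  apply/eqP; rewrite -dimv_eq0.
  by rewrite -(eqn_add2l (\dim (VG i + \sum_(j <- s) VG j))) cap addn0 dimE dims.
have sumV : \sum_(j <- s) x j \in (\sum_(j <- s) VG j)%VS.
  rewrite [X in X \in _]big_seq; apply: memv_suml => j js.
  exact: (subvP (sumv_seq_sup VG js)) (xV j).
have xi0 : x i = 0.
  apply/eqP; rewrite -memv0 -cap0 memv_cap xV.
  by move/eqP: sum0; rewrite addr_eq0 => /eqP->; rewrite memvN.
move: sum0; rewrite xi0 add0r => sum0 j; rewrite inE => /orP[/eqP-> //|].
by apply: IH; rewrite ?dims.
Qed.

(** A decomposition together with its projections: [pi] is defined at every degree, and the finite
    list [s] carries all nonzero components. *)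
Definition component_family (I : eqType) (VG : I -> {vspace V}) (s : seq I)
    (pi : I -> 'End(V)) : Prop :=
  [/\ uniq s, forall i v, pi i v \in VG i, forall v, \sum_(i <- s) pi i v = v
    & forall i j v, v \in VG j -> pi i v = if i == j then v else 0].

Lemma direct_decompositionP (K : zmodType) (VG : K -> {vspace V}) :
  direct_decomposition VG <-> exists s pi, component_family VG s pi.
Proof.
split=> [[dir [s0 sum_s0]]|[s [pi [us piV pi_sum piE]]]]; last first.
  split=> [r ur|]; first exact: directv_of_projections piE.
  exists s; apply/vspaceP => v; rewrite memvf.
  rewrite -(pi_sum v) [X in X \in _]big_seq; apply: memv_suml => i is_.
  exact: (subvP (sumv_seq_sup VG is_)) (piV i v).
pose s := undup s0; have us : uniq s := undup_uniq _.
have sum_s : (\sum_(g <- s) VG g)%VS = fullv.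
  apply/eqP; rewrite eqEsubv subvf -sum_s0 /= big_seq.
  elim/big_rec: _ => [|g W gs IHW]; first exact: sub0v.
  by rewrite subv_add IHW andbT sumv_seq_sup // mem_undup.
pose q := sumv_pi_for (erefl (\sum_(g <- s) VG g)%VS).
(* Off [s] the projection is 0; this is correct since components outside [s] are shown below to
   vanish. *)
pose pi g := if g \in s then q g else 0.
have piV g v : pi g v \in VG g.
  by rewrite /pi; case: ifP => _; rewrite ?lfunE ?mem0v ?memv_sum_pi.
have pi_sum v : \sum_(g <- s) pi g v = v.
  rewrite big_seq; under eq_bigr => g gs do rewrite /pi gs.
  rewrite -big_seq; apply: sumv_pi_uniq_sum; first by rewrite filter_predT.
  by rewrite sum_s memvf.
exists s, pi; split=> // g h v vh.
have [hs|nhs] := boolP (h \in s); last first.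
  have v0 : v = 0.
    (* The vector minus the sum of its components along [s] is a vanishing combination over
       [h :: s]. *)
    pose x k := if k == h then v else - pi k v.
    suff: x h = 0 by rewrite /x eqxx.
    apply: (@directv_independent _ (h :: s) VG x).
    - by rewrite /= nhs.
    - by apply: dir; rewrite /= nhs.
    - by move=> k; rewrite /x; case: eqP => [->|_]; rewrite ?memvN ?piV.
    - rewrite big_cons {1}/x eqxx -[X in X + _](pi_sum v) -big_split /=.
      rewrite big_seq big1 // => k ks; rewrite /x.
      by case: eqP nhs => [<-|_ _]; rewrite ?ks ?subrr.
    - exact: mem_head.
  by rewrite v0 linear0 if_same.
have [gs|ngs] := boolP (g \in s); last first.
  rewrite /pi (negPf ngs) lfunE; case: eqP ngs => // ->; by rewrite hs.
(* Compare the decomposition of [v] by [pi] with the trivial one, concentrated in degree [h]. *)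
pose x k := pi k v - if k == h then v else 0.
suff: x g = 0 by move/eqP; rewrite subr_eq0 => /eqP.
apply: (@directv_independent _ s VG x us _ _ _ g gs) => [|k|].
- exact: dir.
- by rewrite memvB ?piV //; case: eqP => [->|_]; rewrite ?mem0v.
- rewrite sumrB pi_sum (bigD1_seq h) //= eqxx big1 ?addr0 ?subrr //.
  by move=> k /negPf->.
Qed.

End DirectSums.

(** * Graded simple algebras *)

Section Components.
Variables (F : fieldType) (V : vectType F) (I : eqType) (VG : I -> {vspace V}).
Variables (s : seq I) (pi : I -> 'End(V)).
Hypothesis piP : component_family VG s pi.

Lemma mem_component i v : pi i v \in VG i.
Proof. by case: piP. Qed.

Lemma component_id i v : v \in VG i -> pi i v = v.
Proof. by case: piP => _ _ _ piE /piE->; rewrite eqxx. Qed.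

Lemma homogeneous_ind (P : V -> Prop) :
    P 0 -> (forall x y, P x -> P y -> P (x + y)) ->
    (forall i x, x \in VG i -> P x) ->
  forall x, P x.
Proof.
move=> P0 PD Phom x; have [_ piV pi_sum _] := piP; rewrite -(pi_sum x).
by apply: big_ind => // i _; apply: Phom (piV i x).
Qed.

(** This is what allows an element witnessing some nonvanishing to be replaced by a homogeneous
    one. *)
Lemma component_neq0 (W : vectType F) (f : {linear V -> W}) x :
  f x != 0 -> exists i, f (pi i x) != 0.
Proof.
have [_ _ sum_pi _] := piP => fx0.
have [/hasP[i _ fi0]|/hasPn no] := boolP (has (fun i => f (pi i x) != 0) s).
  by exists i.
case/negP: fx0; rewrite -(sum_pi x) linear_sum big_seq big1 //= => i /no.
by rewrite negbK => /eqP.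
Qed.

Lemma subvs_direct_decomposition (W : {vspace V}) :
    (forall i x, x \in W -> pi i x \in W) ->
  component_family
    (fun i => linfun (vsval : subvs_of W -> V) @^-1: VG i)%VS s
    (fun i => linfun (vsproj W \o pi i \o (vsval : subvs_of W -> V))).
Proof.
move=> piW; have qE i (x : subvs_of W) :
    vsval (linfun (vsproj W \o pi i \o (vsval : subvs_of W -> V)) x)
      = pi i (vsval x).
  by rewrite lfunE /= vsprojK //; apply: piW; apply: subvsP.
have [us piV pi_sum pi_id] := piP; split=> // [i x|x|i j x].
- by rewrite -memv_preim lfunE /= qE.
- apply/subvs_inj; rewrite linear_sum /= -[RHS]pi_sum.
  by apply: eq_bigr => i _; rewrite qE.
- rewrite -memv_preim lfunE /= => xj; apply/subvs_inj.
  by rewrite qE (pi_id _ _ _ xj); case: eqP.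
Qed.

End Components.

(** The two-sided ideal generated by [z] is everything. Simplicity is used below mostly in this
    form, with [P] a kernel or a preimage. *)
Lemma simple_algebra_gen (F : fieldType) (A : falgType F) (z : A)
    (P : {vspace A}) :
  simple_algebra A -> z != 0 -> (forall a b, a * z * b \in P) ->
  forall x, x \in P.
Proof.
move=> simpA z0 azbP x; have zI : z \in (fullv * <[z]> * fullv)%VS.
  by rewrite -[z in z \in _]mul1r -[1 * z]mulr1 !memv_mul ?memvf ?memv_line.
have [||I0|Ifull] := simpA (fullv * <[z]> * fullv)%VS.
- by rewrite -prodvA prodvSr ?subvf.
- by rewrite !prodvA !prodvSl ?subvf.
- by move: zI; rewrite I0 memv0 (negPf z0).
suff /subvP : (fullv * <[z]> * fullv <= P)%VS by apply; rewrite Ifull memvf.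
apply/prodvP => y b yz _; have: y \in (amulr b @^-1: P)%VS.
  move: y yz; apply/subvP/prodvP => a _ _ /vlineP[c ->].
  by rewrite -memv_preim lfunE /= -scalerAr -scalerAl memvZ.
by rewrite -memv_preim lfunE.
Qed.

(** If a A b = 0, then left multiplication by a kills the ideal A b A = A, in particular 1. *)
Lemma simple_algebra_prime (F : fieldType) (A : falgType F) (a b : A) :
  simple_algebra A -> a != 0 -> b != 0 -> exists x, a * x * b != 0.
Proof.
move=> simpA a0 b0; apply: NNPP => no; case/negP: a0.
rewrite -[a]mulr1; have: 1 \in lker (amull a); last by rewrite memv_ker lfunE.
apply: (simple_algebra_gen simpA b0) => x y; rewrite memv_ker lfunE /= !mulrA.
suff /eqP-> : a * x * b == 0 by rewrite mul0r.
by apply/negPn/negP=> nz; apply: no; exists x.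
Qed.

Section GradedAlgebra.
Variables (F : fieldType) (K : zmodType) (A : falgType F).
Variables (AG : K -> {vspace A}) (s : seq K) (pi : K -> 'End(A)).
Hypothesis piP : component_family AG s pi.
Hypothesis AGM : forall g h, (AG g * AG h <= AG (g + h)%R)%VS.

Lemma memM_graded g h x y : x \in AG g -> y \in AG h -> x * y \in AG (g + h).
Proof. by move=> xg yh; apply: (subvP (AGM g h)); apply: memv_mul. Qed.

Lemma component_mull g h x y :
  x \in AG g -> pi h (x * y) = x * pi (h - g) y.
Proof.
have [_ _ _ piE] := piP => xg.
elim/(homogeneous_ind piP): y => [|y z IHy IHz|k y yk].
- by rewrite !(mulr0, linear0).
- by rewrite mulrDr !linearD /= IHy IHz mulrDr.
- rewrite (piE _ _ _ (memM_graded xg yk)) (piE _ _ _ yk).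
  by rewrite subr_eq addrC; case: eqP; rewrite ?mulr0.
Qed.

Lemma component_mulr g h x y :
  y \in AG g -> pi h (x * y) = pi (h - g) x * y.
Proof.
have [_ _ _ piE] := piP => yg.
elim/(homogeneous_ind piP): x => [|x z IHx IHz|k x xk].
- by rewrite !(mul0r, linear0).
- by rewrite mulrDl !linearD /= IHx IHz mulrDl.
- rewrite (piE _ _ _ (memM_graded xk yg)) (piE _ _ _ xk).
  by rewrite subr_eq; case: eqP; rewrite ?mul0r.
Qed.

(** The degree 0 component of 1 is a left identity on homogeneous elements, hence on 1 itself. *)
Lemma one_graded : 1 \in AG 0.
Proof.
suff <- : pi 0 1 = 1 by apply: (mem_component piP).
rewrite -[LHS]mulr1; elim/(homogeneous_ind piP): {2 3}(1 : A).
- by rewrite mulr0.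
- by move=> x y ex ey; rewrite mulrDr ex ey.
- move=> g x xg; rewrite -(subrr g) -(component_mulr _ _ xg) mul1r.
  exact: (component_id piP xg).
Qed.

Definition graded_left_ideal (I : {vspace A}) : Prop :=
  (forall a x, x \in I -> a * x \in I) /\ (forall g x, x \in I -> pi g x \in I).

Lemma minimal_graded_left_ideal :
  exists I : {vspace A}, [/\ graded_left_ideal I, I != 0%VS
    & forall J, graded_left_ideal J -> (J <= I)%VS -> J != 0%VS -> (I <= J)%VS].
Proof.
suff ex n : forall I : {vspace A}, (\dim I < n)%N -> graded_left_ideal I ->
    I != 0%VS -> exists I : {vspace A}, [/\ graded_left_ideal I, I != 0%VS
    & forall J, graded_left_ideal J -> (J <= I)%VS -> J != 0%VS -> (I <= J)%VS].
  apply: (ex _ fullv (ltnSn _)) => [|]; first by split=> *; apply: memvf.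
  by rewrite -dimv_eq0 dimvf -lt0n FalgType_proper.
elim: n => // n IHn I ltIn idI I0.
have [[J [idJ leJI J0 ltJI]]|no] := classic (exists J,
    [/\ graded_left_ideal J, (J <= I)%VS, J != 0%VS & ~~ (I <= J)%VS]).
  apply: IHn idJ J0; apply: leq_trans (ltIn : (\dim I <= n)%N).
  by rewrite (ltn_leqif (dimv_leqif_sup leJI)).
exists I; split=> // J idJ leJI J0; apply/negPn/negP=> nle.
by apply: no; exists J.
Qed.

(** Says inside A that e A e, with unit e, is a graded division algebra. *)
Definition division_idempotent (e : A) : Prop :=
  [/\ e \in AG 0, e != 0, e * e = e
    & forall g x, x \in AG g -> x != 0 -> e * x * e = x ->
      exists y, [/\ y \in AG (- g), e * y * e = y, y * x = e & x * y = e]].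

(** The u_i form a homogeneous basis of the right e A e-module A e, with the v_i as dual basis; the
    u_i v_j are matrix units. *)
Record graded_frame (e : A) (k : nat) (g : 'I_k -> K) (u v : 'I_k -> A) :
    Prop := GradedFrame {
  frame_degl : forall i, u i \in AG (g i);
  frame_degr : forall i, v i \in AG (- g i);
  frame_mulre : forall i, u i * e = u i;
  frame_mulel : forall i, e * v i = v i;
  frame_ortho : forall i j, v i * u j = if i == j then e else 0;
  frame_sum1 : \sum_i u i * v i = 1
}.

Hypothesis simpA : simple_algebra A.

Lemma homogeneous_prime a b :
  a != 0 -> b != 0 -> exists g x, x \in AG g /\ a * x * b != 0.
Proof.
move=> a0 b0; have [x] := simple_algebra_prime simpA a0 b0.
pose f := (amulr b \o amull a)%VF.
have fE y : f y = a * y * b by rewrite comp_lfunE !lfunE.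
rewrite -fE => /(component_neq0 piP)[g]; rewrite /= fE => nz.
by exists g, (pi g x); split=> //; apply: (mem_component piP).
Qed.

(* A minimal graded left ideal is generated by an idempotent, as in the      *)
(* ungraded theory (Brauer's lemma).                                         *)
Lemma primitive_homogeneous_idempotent :
  exists e : A, division_idempotent e.
Proof.
have [I [[idI piI] I0 minI]] := minimal_graded_left_ideal.
have [z zI z0] : exists2 z, z \in I & z != 0.
  by exists (vpick I); rewrite ?memv_pick ?vpick0.
(* By primeness z a z is nonzero for some a, so I I is nonzero; passing to components of both
   factors makes them homogeneous. *)
have [x [g [y [h [[xg xI] [yh yI] xy0]]]]] : exists x g y h,
    [/\ x \in AG g /\ x \in I, y \in AG h /\ y \in I & x * y != 0].
  have [a] := simple_algebra_prime simpA z0 z0; rewrite -mulrA.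
  have azI : a * z \in I by apply: idI.
  have -> : z * (a * z) = amull z (a * z) by rewrite lfunE.
  case/(component_neq0 piP) => h; rewrite /= lfunE /= => nz.
  have : amulr (pi h (a * z)) z != 0 by rewrite lfunE.
  case/(component_neq0 piP) => g; rewrite /= lfunE /= => nz'.
  exists (pi g z), g, (pi h (a * z)), h.
  by rewrite !(mem_component piP) !piI.
(* The annihilator of y in I is a graded left ideal that misses x, so minimality of I makes it
   zero. *)
pose ann := (I :&: lker (amulr y))%VS.
have ann0 t : t \in I -> t * y = 0 -> t = 0.
  move=> tI ty; have [/eqP ann0|nz] := boolP (ann == 0%VS).
    by apply/eqP; rewrite -memv0 -ann0 memv_cap tI memv_ker lfunE /= ty.
  case/negP: xy0; have /minI : graded_left_ideal ann.
    split=> [a r|k r]; rewrite !memv_cap !memv_ker !lfunE /=.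
      by case/andP=> rI /eqP ry; rewrite idI // -mulrA ry mulr0 /=.
    case/andP=> rI /eqP ry; rewrite piI //=; apply/eqP.
    by rewrite -[k](addrK h) -(component_mulr _ _ yh) ry linear0.
  case/(_ (capvSl _ _) nz)/subvP/(_ _ xI)/memv_capP => _.
  by rewrite memv_ker lfunE.
(* I t is a nonzero graded left ideal inside I, hence equals I; so r t = w is solvable with r
   homogeneous in I. *)
have gen t k : t \in AG k -> t \in I -> (exists2 r, r \in I & r * t != 0) ->
    forall i w, w \in AG i -> w \in I ->
    exists2 r, r \in AG (i - k) & r \in I /\ r * t = w.
  move=> tk tI [r rI rt0] i w wi wI.
  have idIt : graded_left_ideal (amulr t @: I).
    split=> [a _ /memv_imgP[q qI ->]|j _ /memv_imgP[q qI ->]].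
      by apply/memv_imgP; exists (a * q); rewrite ?idI // !lfunE /= mulrA.
    apply/memv_imgP; exists (pi (j - k) q); first exact: piI.
    by rewrite !lfunE /= (component_mulr _ _ tk).
  have leIt : (amulr t @: I <= I)%VS.
    by apply/subvP=> _ /memv_imgP[q qI ->]; rewrite lfunE /= idI.
  have It0 : (amulr t @: I)%VS != 0%VS.
    apply: contraNneq rt0 => im0; rewrite -memv0 -im0; apply/memv_imgP.
    by exists r; rewrite ?lfunE.
  have /memv_imgP[q qI wE] := subvP (minI _ idIt leIt It0) _ wI.
  exists (pi (i - k) q); first exact: (mem_component piP).
  split; first exact: piI.
  by rewrite -(component_mulr _ _ tk) -(component_id piP wi) wE lfunE.
(* Solve e y = y in I; then e e - e annihilates y, which makes e idempotent. *)
have [e e0 [eI ey]] : exists2 e, e \in AG 0 & e \in I /\ e * y = y.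
  by rewrite -(subrr h); apply: (gen _ _ yh yI) => //; exists x.
have yn0 : y != 0 by apply: contraNneq xy0 => ->; rewrite mulr0.
have en0 : e != 0 by apply: contraNneq yn0 => e_0; rewrite -ey e_0 mul0r.
have ee : e * e = e.
  apply/eqP; rewrite -subr_eq0; apply/eqP/ann0.
    by rewrite memvB // idI.
  by rewrite mulrBl -mulrA !ey subrr.
have linv g' x' : x' \in AG g' -> x' != 0 -> e * x' * e = x' ->
    exists y', [/\ y' \in AG (- g'), e * y' * e = y' & y' * x' = e].
  move=> xg' xn0 exe; have xI' : x' \in I by rewrite -exe idI.
  have ex : e * x' = x' by rewrite -exe !mulrA ee.
  have [|r rg [rI rx]] := gen _ _ xg' xI' _ _ _ e0 eI.
    by exists e; rewrite ?ex.
  exists (e * r * e); split.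
  - rewrite -[- g']add0r -[X in AG X]addr0 memM_graded //.
    by rewrite -[X in AG X]add0r memM_graded // -sub0r.
  - by rewrite !mulrA ee -!mulrA ee.
  - by rewrite -!mulrA ex rx ee.
exists e; split=> // g' x' xg' xn0 exe.
have [y' [yg' eye yx]] := linv g' x' xg' xn0 exe; exists y'; split=> //.
have yn0' : y' != 0 by apply: contraNneq en0 => y_0; rewrite -yx y_0 mul0r.
(* The left inverse y' has itself a left inverse z', and z' = x', so inverses are two-sided. *)
have [z' [_ eze zy]] := linv _ _ yg' yn0' eye.
have ex : e * x' = x' by rewrite -exe !mulrA ee.
have ze : z' * e = z' by rewrite -eze -!mulrA ee.
by have -> : x' = z' by rewrite -ex -zy -mulrA yx ze.
Qed.

(* Peel off one summand [u v] of the idempotent [f] at a time; the right     *)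
(* ideal [f A] shrinks strictly.                                             *)
Lemma idempotent_frame (e f : A) :
    division_idempotent e -> f \in AG 0 -> f * f = f ->
  exists k (g : nat -> K) (u v : nat -> A),
    [/\ forall i, (i < k)%N -> [/\ u i \in AG (g i), v i \in AG (- g i),
          u i * e = u i & e * v i = v i],
        forall i, (i < k)%N -> f * u i = u i /\ v i * f = v i,
        forall i j, (i < k)%N -> (j < k)%N ->
          v i * u j = if i == j then e else 0
      & \sum_(i < k) u i * v i = f].
Proof.
case=> eG e0 ee divE; have [n] := ubnP (\dim (amull f @: fullv)).
elim: n f => // n IHn f ltfn fG ff.
have [f0|f0] := eqVneq f 0.
  by exists 0, (fun=> 0), (fun=> 0), (fun=> 0); split=> //; rewrite big_ord0.
have [g0 [x [xg fxe]]] := homogeneous_prime f0 e0.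
have [u0 u0E] : exists u0, u0 = f * x * e by exists (f * x * e).
have u0g : u0 \in AG g0.
  by rewrite u0E -[g0]add0r -[X in AG X]addr0 !memM_graded.
have u0e : u0 * e = u0 by rewrite u0E -mulrA ee.
have fu0 : f * u0 = u0 by rewrite u0E !mulrA ff.
(* By primeness again e w u0 is nonzero; its inverse y in e A e yields v0 = y w f with v0 u0 = e. *)
have [g1 [w [wg]]] := homogeneous_prime e0 fxe; rewrite -u0E => ewu.
have ewuG : e * w * u0 \in AG (g1 + g0).
  by rewrite -[X in X + _]add0r !memM_graded.
have [|y [yG eye y_inv _]] := divE _ _ ewuG ewu.
  by rewrite -!mulrA u0e !mulrA ee.
have ey : e * y = y by rewrite -eye !mulrA ee.
have ye : y * e = y by rewrite -eye -!mulrA ee.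
have [v0 v0E] : exists v0, v0 = y * w * f by exists (y * w * f).
have v0g : v0 \in AG (- g0).
  have -> : - g0 = - (g1 + g0) + g1 + 0 by rewrite opprD addr0 addrAC addNr add0r.
  by rewrite v0E !memM_graded.
have v0u0 : v0 * u0 = e.
  by rewrite -y_inv v0E -[_ * f * _]mulrA fu0 !mulrA ye.
have ev0 : e * v0 = v0 by rewrite v0E !mulrA ey.
have v0f : v0 * f = v0 by rewrite v0E -mulrA ff.
(* u0 v0 is an idempotent below f, and f' is its complement in f. *)
pose f' := f - u0 * v0.
have ff' : f * f' = f' by rewrite /f' mulrBr ff mulrA fu0.
have f'f : f' * f = f' by rewrite /f' mulrBl ff -mulrA v0f.
have v0f' : v0 * f' = 0 by rewrite /f' mulrBr v0f mulrA v0u0 ev0 subrr.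
have f'u0 : f' * u0 = 0 by rewrite /f' mulrBl fu0 -mulrA v0u0 u0e subrr.
have f'f' : f' * f' = f'.
  by rewrite {1}/f' mulrBl ff' -mulrA v0f' mulr0 subr0.
have f'G : f' \in AG 0.
  by rewrite memvB // -(subrr g0) memM_graded.
(* The inclusion of f' A in f A is strict: u0 lies in f A, but f' u0 = 0. *)
have [|k [g [u [v [uvG uvf uvo uvs]]]]] := IHn f' _ f'G f'f'.
  have lef : (amull f' @: fullv <= amull f @: fullv)%VS.
    apply/subvP=> _ /memv_imgP[q _ ->]; apply/memv_imgP; exists (f' * q).
      exact: memvf.
    by rewrite !lfunE /= mulrA ff'.
  apply: leq_trans (ltfn : (_ <= n)%N).
  rewrite (ltn_leqif (dimv_leqif_sup lef)); apply/negP=> /subvP le_f.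
  have /le_f/memv_imgP[q _] : u0 \in (amull f @: fullv)%VS.
    by apply/memv_imgP; exists u0; rewrite ?memvf // lfunE /= fu0.
  rewrite lfunE /= => u0q; case/negP: fxe; rewrite -u0E u0q -f'f' -mulrA -u0q.
  by rewrite f'u0.
exists k.+1, (fun i => if i is i'.+1 then g i' else g0),
  (fun i => if i is i'.+1 then u i' else u0),
  (fun i => if i is i'.+1 then v i' else v0); split.
- by case=> [_|i /uvG].
- case=> [//|i /uvf[fu vf]]; split; first by rewrite -fu mulrA ff'.
  by rewrite -vf -mulrA f'f.
- case=> [|i] [|j] //= ik jk.
  + by have [<- _] := uvf j jk; rewrite mulrA v0f' mul0r.
  + by have [_ <-] := uvf i ik; rewrite -mulrA f'u0 mulr0.
  + exact: uvo.
- by rewrite big_ord_recl uvs /f' addrC subrK.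
Qed.

Lemma division_idempotent_frame (e : A) :
  division_idempotent e ->
  exists k (g : 'I_k -> K) (u v : 'I_k -> A), graded_frame e g u v.
Proof.
move=> eP; have := idempotent_frame eP one_graded (mulr1 1).
case=> k [g [u [v [uvG _ uvo uvs]]]].
exists k, (g \o val), (u \o val), (v \o val); split=> // [i|i|i|i|i j].
1-4: by have [] := uvG i (ltn_ord i).
by rewrite /= uvo.
Qed.

End GradedAlgebra.

(** * Corners and graded division algebras *)

Lemma lfun_eigenvector (F : closedFieldType) (V : vectType F) (f : 'End(V)) :
  (0 < dim V)%N -> exists a u, u != 0 /\ f u = a *: u.
Proof.
move=> dimV; have b := vbasisP {:V};
  pose M := passmx.mxof (vbasis {:V}) (vbasis {:V}) f.
have /closed_rootP[a] : size (char_poly M) != 1%N.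
  by rewrite size_char_poly dimvf eqSS -lt0n.
rewrite -eigenvalue_root_char /eigenvalue -(passmx.vsof_eq0 b).
rewrite -(passmx.leigenspaceE b) -vpick0.
set u := vpick _ => u0; exists a, u; split=> //.
apply/eqP; have: u \in passmx.leigenspace f a := memv_pick _.
by rewrite memv_ker !lfun_simp subr_eq0.
Qed.

Lemma lfun_eigenvector_sub (F : closedFieldType) (V : vectType F)
    (f : 'End(V)) (U : {vspace V}) :
  U != 0%VS -> (f @: U <= U)%VS -> exists a u, [/\ u \in U, u != 0 & f u = a *: u].
Proof.
move=> U0 fU; pose g : 'End(subvs_of U) := (linfun (vsproj U) \o f \o linfun vsval)%VF.
have [|a [u [u0 gu]]] := lfun_eigenvector g.
  rewrite -dimvf lt0n dimv_eq0; apply: contraNneq U0 => full0.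
  have pU := memv_pick U; rewrite -vpick0; apply/eqP.
  have: vsproj U (vpick U) \in {: subvs_of U}%VS by exact: memvf.
  by rewrite full0 memv0 => /eqP vp0; rewrite -(vsprojK pU) vp0.
exists a, (vsval u); split; first exact: subvsP.
  by apply: contraNneq u0 => vu0; apply/eqP/subvs_inj.
move/(congr1 vsval): gu; rewrite !comp_lfunE !lfunE /=.
by rewrite vsprojK // (subvP fU) // memv_img // subvsP.
Qed.

(** An eigenspace of the first operator is stable under those that commute with it, so the induction
    continues inside it. *)
Lemma lfun_common_eigenvector (F : closedFieldType) (V : vectType F) (I : eqType)
    (s : seq I) (f : I -> 'End(V)) (U : {vspace V}) :
    {in s &, forall i j, (f i \o f j = f j \o f i)%VF} ->
    U != 0%VS -> {in s, forall i, (f i @: U <= U)%VS} ->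
  exists a u, [/\ u \in U, u != 0 & {in s, forall i, f i u = a i *: u}].
Proof.
elim: s U => [|i s IH] U comm U0 fU.
  by exists (fun=> 0), (vpick U); rewrite memv_pick vpick0.
have [c [w [wU w0 fw]]] := lfun_eigenvector_sub U0 (fU i (mem_head _ _)).
pose W := (U :&: lker (f i - c *: \1%VF))%VS.
have memW x : (x \in W) = (x \in U) && (f i x == c *: x).
  by rewrite memv_cap memv_ker !lfun_simp subr_eq0.
have [||j js|a [u [uW u0 fu]]] := IH W.
- by move=> j k js ks; apply: comm; rewrite inE ?js ?ks orbT.
- by apply: contraNneq w0 => W0; rewrite -memv0 -W0 memW wU fw eqxx.
- have js' : j \in i :: s by rewrite inE js orbT.
  apply/subvP=> _ /memv_imgP[x + ->]; rewrite !memW => /andP[xU /eqP fx].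
  rewrite (subvP (fU j js')) ?memv_img //=.
  by rewrite -!comp_lfunE comm ?mem_head // comp_lfunE fx linearZ.
move: uW; rewrite memW => /andP[uU /eqP fiu].
exists (fun j => if j == i then c else a j), u; split=> // j.
by rewrite inE; case: eqP => [-> //|_ /= /fu].
Qed.

Section Corner.
Variables (F : fieldType) (A : falgType F) (e : A).
Hypotheses (ee : e * e = e) (e_neq0 : e != 0).

Definition corner : {vspace A} := lker (amulr e \o amull e - \1)%VF.

Lemma mem_corner x : (x \in corner) = (e * x * e == x).
Proof. by rewrite memv_ker !lfun_simp /= subr_eq0. Qed.

Lemma corner_mull x : x \in corner -> e * x = x.
Proof. by rewrite mem_corner => /eqP <-; rewrite !mulrA ee. Qed.

Lemma corner_mulr x : x \in corner -> x * e = x.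
Proof. by rewrite mem_corner => /eqP <-; rewrite -!mulrA ee. Qed.

Lemma corner_conj x : e * x * e \in corner.
Proof. by rewrite mem_corner !mulrA ee -[_ * e * e]mulrA ee. Qed.

Lemma corner_subproof : is_aspace corner.
Proof.
apply/andP; split; last first.
  apply/prodvP => x y xe ye.
  by rewrite mem_corner mulrA (corner_mull xe) -mulrA (corner_mulr ye).
apply/has_algidP; exists e; split=> // [|x xe]; first by rewrite mem_corner !ee.
by rewrite (corner_mull xe) (corner_mulr xe).
Qed.

Definition corner_aspace : {aspace A} := ASpace corner_subproof.
Definition corner_alg : falgType F := subvs_of corner_aspace.

Lemma val_corner1 : vsval (1 : corner_alg) = e.
Proof.
have eC : e \in corner_aspace by rewrite /= mem_corner !ee.
rewrite -(algidr eC); exact/esym/corner_mull/memv_algid.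
Qed.

Lemma val_cornerM (x y : corner_alg) : vsval (x * y) = vsval x * vsval y.
Proof. by []. Qed.

(** The compression f x = e x e satisfies f (a z b) = f a z f b for z in the corner. So the preimage
    under f of an ideal containing z contains A z A, which is A when z is nonzero. *)
Lemma corner_simple : simple_algebra A -> simple_algebra corner_alg.
Proof.
move=> simpA I idr idl; have [I0|I0] := eqVneq I 0%VS; [by left | right].
pose z := vpick I; have zI : z \in I := memv_pick I.
have vz0 : vsval z != 0.
  by apply: contraNneq I0 => vz; rewrite -vpick0 -(inj_eq (@subvs_inj _ _ _)) vz.
pose p (x : A) : corner_alg := vsproj corner_aspace (e * x * e).
pose f := (linfun (vsproj corner_aspace) \o amulr e \o amull e)%VF.
have vp x : vsval (f x : corner_alg) = e * x * e.
  by rewrite !comp_lfunE !lfunE /= vsprojK // corner_conj.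
have simp := simple_algebra_gen simpA vz0 (P := f @^-1: I).
apply/vspaceP=> x; rewrite memvf.
have -> : x = f (vsval x).
  apply/subvs_inj; rewrite vp; apply/esym/eqP; rewrite -mem_corner.
  exact: subvsP.
rewrite memv_preim; apply: simp => a b; rewrite -memv_preim.
have -> : f (a * vsval z * b) = (f a : corner_alg) * z * f b.
  apply/subvs_inj; rewrite vp !val_cornerM !vp.
  have zl := corner_mull (subvsP z : _ \in corner).
  have zr := corner_mulr (subvsP z : _ \in corner).
  rewrite -[e * a * e * _]mulrA zl.
  have -> : e * a * vsval z * (e * b * e) = e * a * (vsval z * e) * b * e.
    by rewrite !mulrA.
  by rewrite zr !mulrA.
by apply: (subvP idr); apply: memv_mul (memvf _); apply: (subvP idl);
  apply: memv_mul (memvf _) zI.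
Qed.

Variables (K : zmodType) (AG : K -> {vspace A}).

Definition corner_grading (g : K) : {vspace corner_alg} :=
  (linfun (vsval : corner_alg -> A) @^-1: AG g)%VS.

Lemma mem_corner_grading g x : (x \in corner_grading g) = (vsval x \in AG g).
Proof. by rewrite -memv_preim lfunE. Qed.

Lemma corner_is_grading :
  is_grading AG -> e \in AG 0 -> is_grading corner_grading.
Proof.
move=> [/direct_decompositionP[s [pi piP]] AGM] eG; split; last first.
  move=> g h; apply/prodvP => x y; rewrite !mem_corner_grading => xg yh.
  by rewrite val_cornerM; apply: (memM_graded AGM).
have piC g x : x \in corner -> pi g x \in corner.
  rewrite !mem_corner => /eqP xe.
  by rewrite -{2}xe (component_mulr piP AGM _ _ eG) subr0
    (component_mull piP AGM _ _ eG) subr0.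
apply/direct_decompositionP; do 2!eexists.
exact: (subvs_direct_decomposition piP piC).
Qed.

End Corner.

Lemma corner_graded_division (F : fieldType) (K : zmodType) (A : falgType F)
    (AG : K -> {vspace A}) (e : A) (ee : e * e = e) (e0 : e != 0) :
    is_grading AG -> division_idempotent AG e ->
  graded_division (corner_grading ee e0 AG).
Proof.
move=> gA [eG _ _ divE]; split; first exact: corner_is_grading.
move=> g x; rewrite mem_corner_grading => xg x0.
have [||y [yg eye yx xy]] := divE g (vsval x) xg.
- by apply: contraNneq x0 => vx; apply/eqP/subvs_inj.
- by apply/eqP; rewrite -mem_corner; exact: subvsP.
have yC : y \in corner_aspace ee e0 by rewrite /= mem_corner eye.
apply/unitrP; exists (Subvs yC); split; apply/subvs_inj.
  by rewrite val_cornerM val_corner1.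
by rewrite val_cornerM val_corner1.
Qed.

(** An eigenvector u of left multiplication by x gives (x - a) u = 0 with u nonzero. *)
Lemma falg_eigenvalue (F : closedFieldType) (D : falgType F) (x : D) :
  exists a, x - a%:A \isn't a GRing.unit.
Proof.
have [a [u [u0 xu]]] := lfun_eigenvector (amull x) (FalgType_proper D).
exists a; apply: contraNN u0 => xU; rewrite -(inj_eq (mulrI xU)) mulr0.
by rewrite mulrBl -scalerAl mul1r subr_eq0 -xu lfunE.
Qed.

(** Some z = x - a is not a unit. It is central, so if it were nonzero the ideal z D would be D and
    z would be invertible. *)
Lemma simple_center (F : closedFieldType) (D : falgType F) (x : D) :
  simple_algebra D -> (forall y, x * y = y * x) -> exists a, x = a%:A.
Proof.
move=> simpD xC; have [a xa] := falg_eigenvalue x; exists a.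
apply/eqP; rewrite -subr_eq0; set z := x - a%:A in xa *.
have zC y : z * y = y * z.
  by rewrite mulrBl mulrBr xC -scalerAl -scalerAr mul1r mulr1.
apply: contraNT xa => z0; have: 1 \in limg (amull z).
  apply: (simple_algebra_gen simpD z0) => b c; apply/memv_imgP.
  by exists (b * c); rewrite ?memvf // lfunE /= -zC mulrA.
case/memv_imgP => y _; rewrite lfunE /= => yz.
by apply/unitrP; exists y; rewrite -zC -yz.
Qed.

Section GradedDivision.
Variables (F : closedFieldType) (G : zmodType) (D : falgType F).
Variable DG : Gsharp G -> {vspace D}.
Hypothesis divD : graded_division DG.

Let DGM : forall g h, (DG g * DG h <= DG (g + h)%R)%VS.
Proof. by case: divD => [[]]. Qed.

Let unitD g x : x \in DG g -> x != 0 -> x \is a GRing.unit.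
Proof. by case: divD => _ h; apply: h. Qed.

Let components : exists s pi, component_family DG s pi.
Proof. by apply/direct_decompositionP; case: divD => [[]]. Qed.

Let DG1 : 1 \in DG 0.
Proof. by have [s [pi piP]] := components; apply: one_graded piP DGM. Qed.

Lemma graded_division_scalar x : x \in DG 0 -> exists a, x = a%:A.
Proof.
move=> x0; have [a xa] := falg_eigenvalue x; exists a; apply/eqP.
rewrite -subr_eq0; apply: contraNT xa; apply: (@unitD 0).
by rewrite memvB // memvZ.
Qed.

(** The component of degree -g of the inverse is already an inverse. *)
Lemma graded_invr g x : x \in DG g -> x != 0 -> x^-1 \in DG (- g).
Proof.
move=> xg x0; have xU := unitD xg x0.
have [s [pi piP]] := components.
have := component_mull piP DGM 0 x^-1 xg.
rewrite divrr // sub0r (component_id piP DG1) => xE.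
have -> : x^-1 = pi (- g) x^-1 by apply: (mulrI xU); rewrite divrr.
exact: mem_component piP _ _.
Qed.

Lemma graded_division_line g x y :
  x \in DG g -> x != 0 -> y \in DG g -> exists a, y = a *: x.
Proof.
move=> xg x0 yg; have xU := unitD xg x0.
have [|a aE] := @graded_division_scalar (y * x^-1).
  by rewrite -(subrr g) (memM_graded DGM) // graded_invr.
by exists a; rewrite -[y](divrK xU) aE -scalerAl mul1r.
Qed.

Lemma graded_division_dim g : \dim (DG g) = (DG g != 0%VS).
Proof.
have [->|g0] := eqVneq; first by rewrite dimv0.
have xg := memv_pick (DG g); rewrite -vpick0 in g0.
suff -> : DG g = <[vpick (DG g)]>%VS by rewrite dim_vline g0.
apply/eqP; rewrite eqEsubv -memvE xg andbT; apply/subvP=> y yg.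
by apply/vlineP; apply: graded_division_line xg g0 yg.
Qed.

(** T is the support, and beta(u,v) is the scalar X_u X_v (X_v X_u)^-1 of degree 0. Nondegeneracy
    holds because the center of D consists of scalars. *)
Lemma graded_division_associated : simple_algebra D ->
  exists T beta, [/\ is_subgroup T, nondeg_alt_bicharacter T beta
    & associated_division T beta DG].
Proof.
move=> simpD; have [s [pi piP]] := components.
have sG g : DG g != 0%VS -> g \in s.
  move=> g0; have xg := memv_pick (DG g); rewrite -vpick0 in g0.
  have [_ _ pi_sum piE] := piP; apply: contraR g0 => ngs.
  rewrite -[vpick _]pi_sum big_seq big1 // => h hs.
  by rewrite (piE _ _ _ xg); case: eqP hs ngs => // -> ->.
pose T := [fset g in s | DG g != 0%VS]%fset.
have memT g : (g \in T) = (DG g != 0%VS).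
  by rewrite !inE /= andb_idl // => /sG.
pose X g := vpick (DG g).
have XG g : X g \in DG g := memv_pick _.
have X0 g : g \in T -> X g != 0 by rewrite memT vpick0.
have XU g : g \in T -> X g \is a GRing.unit by move=> /X0; apply: unitD.
have nzT g x : x \in DG g -> x != 0 -> g \in T.
  move=> xg x0; rewrite memT; apply: contraNneq x0 => g0.
  by rewrite -memv0 -g0.
have nzU (x : D) : x \is a GRing.unit -> x != 0.
  by apply: contraTneq => ->; rewrite unitr0.
pose q (u v : Gsharp G) : D := X u * X v / (X v * X u).
(* The coordinate along 1 extracts the scalar as a function of u and v. *)
pose beta (u v : Gsharp G) : F := coord [tuple (1 : D)] ord0 (q u v).
have qE u v : u \in T -> v \in T -> q u v = (beta u v)%:A.
  move=> uT vT; have q0 : q u v \in DG 0.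
    rewrite -(subrr (u + v)) (memM_graded DGM) ?graded_invr //.
    - by rewrite (memM_graded DGM).
    - by rewrite addrC (memM_graded DGM).
    - by rewrite nzU // unitrMl ?XU.
  have q1 : q u v \in <<[tuple (1%R : D)]>>%VS.
    have [a ->] := graded_division_scalar q0.
    by rewrite span_seq1 memvZ ?memv_line.
  by rewrite [LHS](coord_span q1) big_ord1.
have line g x : g \in T -> x \in DG g -> exists a, x = a *: X g.
  by move=> gT; apply: graded_division_line (XG g) (X0 g gT).
have XC u v : u \in T -> v \in T -> X u * X v = beta u v *: (X v * X u).
  move=> uT vT; rewrite -[LHS](divrK (x := X v * X u)) ?unitrMl ?XU //.
  by rewrite [X in X * _]qE // -scalerAl mul1r.
have comm : {in T &, forall u v (x y : D),
    x \in DG u -> y \in DG v -> x * y = beta u v *: (y * x)}.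
  move=> u v uT vT x y /(line _ _ uT)[a ->] /(line _ _ vT)[b ->].
  rewrite -!scalerAl -!scalerAr XC // !scalerA; congr (_ *: _).
  by rewrite mulrC (mulrC a) mulrA.
(* A single pair of nonzero homogeneous elements determines the commutation factor; multiplicativity
   and alternation follow by choosing pairs. *)
have comm1 u v c x y : u \in T -> v \in T -> x \in DG u -> y \in DG v ->
    x != 0 -> y != 0 -> x * y = c *: (y * x) -> beta u v = c.
  move=> uT vT xu yv x0 y0; rewrite (comm u v) // => /eqP.
  rewrite -subr_eq0 -scalerBl scaler_eq0 subr_eq0 => /orP[/eqP//|].
  by rewrite (negPf (nzU _ _)) // unitrMl ?(unitD xu) ?(unitD yv).
have TM u v : u \in T -> v \in T -> X u * X v \in DG (u + v) /\ X u * X v != 0.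
  by move=> uT vT; rewrite nzU ?unitrMl ?XU // (memM_graded DGM).
have TD u v : u \in T -> v \in T -> u + v \in T.
  by move=> uT vT; have [] := TM u v uT vT; apply: nzT.
have TN u : u \in T -> - u \in T.
  move=> uT; apply: (nzT _ (X u)^-1); first by rewrite graded_invr ?X0.
  by rewrite nzU // unitrV XU.
exists T, beta; split; first split.
- by apply: (nzT _ 1) => //; apply: oner_neq0.
- by move=> u v uT vT; rewrite TD ?TN.
- split.
  + move=> u v uT vT; apply: contra_neq (TM u v uT vT).2 => b0.
    by rewrite XC // b0 scale0r.
  + move=> u v w uT vT wT; have [xy_uv xy0] := TM u v uT vT.
    apply: (comm1 _ _ _ _ _ (TD u v uT vT) wT xy_uv (XG w) xy0 (X0 w wT)).
    rewrite -mulrA (XC v w) // -scalerAr mulrA (XC u w) // -scalerAl scalerA.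
    by rewrite -mulrA mulrC.
  + move=> u v w uT vT wT; have [xy_vw xy0] := TM v w vT wT.
    apply: (comm1 _ _ _ _ _ uT (TD v w vT wT) (XG u) xy_vw (X0 u uT) xy0).
    by rewrite mulrA (XC u v) // -scalerAl -mulrA (XC u w) // -scalerAr scalerA mulrA.
  + move=> t tT; apply: (comm1 _ _ _ _ _ tT tT (XG t) (XG t)); rewrite ?X0 //.
    by rewrite scale1r.
  (* For t in the radical, X_t commutes with all homogeneous elements, so it is central, hence a
     scalar, hence of degree 0. *)
  + move=> t tT bt; have [|a Xa] := simple_center (x := X t) simpD.
      elim/(homogeneous_ind piP) => [|x y IHx IHy|g x xg].
      - by rewrite mulr0 mul0r.
      - by rewrite mulrDr mulrDl IHx IHy.
      - have [->|x0] := eqVneq x 0; first by rewrite mulr0 mul0r.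
        by have gT := nzT _ _ xg x0; rewrite (comm t g) // bt // scale1r.
    apply/eqP; apply: contraTT (X0 t tT) => t0; rewrite negbK.
    have [_ _ _ piE] := piP; rewrite -(component_id piP (XG t)) Xa.
    by rewrite (piE _ 0) ?memvZ // (negPf t0).
split=> // t tT.
by rewrite graded_division_dim -memT tT.
Qed.

End GradedDivision.

(** * The superalgebra M(m,n) *)

Lemma Z2_cases (p : 'Z_2) : p = 0 \/ p = 1.
Proof. by case: p => [[|[|//]] ?]; [left | right]; apply: val_inj. Qed.

Lemma Z2_add11 : (1 + 1 : 'Z_2) = 0.
Proof. exact: val_inj. Qed.

Section Parity.
Variables (F : fieldType) (m n : nat).
Local Notation Mmn := ('M[F]_(m.+1 + n.+1)).

Lemma parity_disjoint : (parity_part F m n 0%R :&: parity_part F m n 1%R = 0)%VS.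
Proof.
apply/eqP; rewrite -subv0; apply/subvP => a; rewrite memv_cap memv0.
rewrite mem_even_part mem_odd_part.
case/andP=> /andP[/eqP ur /eqP dl] /andP[/eqP ul /eqP dr].
by rewrite -[a]submxK ul ur dl dr block_mx0.
Qed.

Lemma parity_mul (p q : 'Z_2) :
  (parity_part F m n p * parity_part F m n q <= parity_part F m n (p + q)%R)%VS.
Proof.
suff mulP (a b : Mmn) : a \in parity_part F m n p -> b \in parity_part F m n q ->
    a *m b \in parity_part F m n (p + q).
  by apply/prodvP => a b; apply: mulP.
rewrite -[a]submxK -[b]submxK mulmx_block.
case: (Z2_cases p) (Z2_cases q) => -> [] ->;
  rewrite ?Z2_add11 ?add0r ?addr0 ?mem_even_part ?mem_odd_part;
  rewrite !(block_mxKul, block_mxKur, block_mxKdl, block_mxKdr).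
all: case/andP=> /eqP-> /eqP-> /andP[/eqP-> /eqP->].
all: by rewrite !(mulmx0, mul0mx, addr0, eqxx).
Qed.

Variable G : zmodType.

Lemma sharp_is_grading (Gam : G -> {vspace Mmn}) :
  super_grading Gam -> is_grading (sharp_grading Gam).
Proof.
move=> [[/direct_decompositionP[s [pi piP]] GamM] superG]; split; last first.
  move=> x y; apply/prodvP => a b; move=> /memv_capP[ax ap] /memv_capP[bx bp].
  apply/memv_capP; split; first exact: (memM_graded GamM).
  by apply: (subvP (parity_mul _ _)); apply: memv_mul.
have [us piV pi_sum pi_id] := piP.
pose P := parity_part F m n.
(* [q p] is a projection only on P 0 + P 1; every component of [Gam] lies there because the grading
   respects parity. *)
pose q (p : 'Z_2) := daddv_pi (P p) (P (p + 1)).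
have disj p : (P p :&: P (p + 1)%R = 0)%VS.
  case: (Z2_cases p) => ->; first exact: parity_disjoint.
  by rewrite capvC; apply: parity_disjoint.
have q_id p r a : a \in P r -> q p a = if p == r then a else 0.
  move=> ar; case: eqP => [->|/eqP npr]; first exact: daddv_pi_id.
  have rE : r = p + 1.
    move: npr; case: (Z2_cases p) (Z2_cases r) => -> [] ->;
      by rewrite ?Z2_add11 ?add0r.
  have disj' : (P (p + 1)%R :&: P p = 0)%VS by rewrite capvC.
  have ar' : a \in P (p + 1) by rewrite -rE.
  have := daddv_pi_add (disj p) (subvP (addvSr _ _) a ar').
  rewrite (daddv_pi_id disj' ar') -[RHS]add0r => /addIr.
  exact.
have q_sum g a : a \in Gam g -> q 0 a + q 1 a = a /\ forall p, q p a \in Gam g.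
  rewrite {1}superG.
  case/memv_addP => a0 /memv_capP[a0g a0P] [a1 /memv_capP[a1g a1P] ->].
  have qE p : q p (a0 + a1) = if p == 0 then a0 else a1.
    rewrite linearD /= (q_id _ _ _ a0P) (q_id _ _ _ a1P).
    by case: (Z2_cases p) => ->; rewrite ?addr0 ?add0r.
  split=> [|p]; first by rewrite !qE.
  by rewrite qE; case: eqP.
apply/direct_decompositionP.
exists [seq (g, p) | g <- s, p <- [:: 0; 1]], (fun x => q x.2 \o pi x.1)%VF.
split=> [|[g p] a|a|[g p] [h r] a].
- by apply: allpairs_uniq => // -[? ?] [? ?].
- rewrite comp_lfunE memv_cap (q_sum g _ (piV g a)).2 /=; apply: memv_pi.
- rewrite big_allpairs -[RHS]pi_sum; apply: eq_bigr => g _.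
  by rewrite big_cons big_seq1 !comp_lfunE /= (q_sum g _ (piV g a)).1.
- rewrite memv_cap /= comp_lfunE => /andP[ah ar].
  rewrite (pi_id _ _ _ ah) xpair_eqE; case: eqP => _; last exact: linear0.
  exact: q_id.
Qed.

End Parity.

(** If z_pq is nonzero, the products E_ip z E_qi = z_pq E_ii recover the identity matrix. *)
Lemma matrix_simple (F : fieldType) (n : nat) : simple_algebra 'M[F]_n.+1.
Proof.
move=> I idr idl; have [I0|I0] := eqVneq I 0%VS; [by left | right].
have zI := memv_pick I; move: I0; rewrite -vpick0; set z := vpick I in zI * => z0.
have [p [q zpq]] : exists p q, z p q != 0.
  apply: NNPP => no; case/negP: z0; apply/eqP/matrixP => p q; rewrite mxE.
  by apply/eqP/negPn/negP=> nz; apply: no; exists p, q.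
apply/vspaceP => x; rewrite memvf.
have <- : x *m (\sum_i (z p q)^-1 *: (delta_mx i p *m z *m delta_mx q i)) = x.
  have d i : delta_mx i p *m z *m delta_mx q i = z p q *: delta_mx i i :> 'M_n.+1.
    apply/matrixP=> k l; rewrite !mxE (bigD1 q) //= big1 => [|j jq]; last first.
      by rewrite !mxE (negPf jq) mulr0.
    rewrite !mxE (bigD1 p) //= big1 => [|j jp]; last first.
      by rewrite !mxE (negPf jp) andbF mul0r.
    rewrite !mxE !eqxx !addr0 andbT /=.
    by case: (k == i); case: (l == i); rewrite ?(mul1r, mul0r, mulr1, mulr0).
  under eq_bigr => i _ do rewrite d scalerA mulVf // scale1r.
  rewrite -[RHS]mulmx1; congr (_ *m _); apply/matrixP=> k l.
  rewrite summxE mxE (bigD1 k) //= !mxE eqxx /= big1 ?addr0 ?[l == k]eq_sym //.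
  by move=> i ik; rewrite mxE eq_sym (negPf ik).
apply: (subvP idl); apply: memv_mul (memvf _) _.
apply: memv_suml => i _; apply: memvZ; apply: (subvP idr).
apply: memv_mul (memvf _); apply: (subvP idl); exact: memv_mul (memvf _) zI.
Qed.

(** * Matrices attached to a frame *)

Lemma lfun_of_linear (F : fieldType) (V W : vectType F) (f : V -> W) :
  linear f -> {h : 'Hom(V, W) | h =1 f}.
Proof.
move=> lf; pose L := GRing.isLinear.Build F V W _ f lf.
pose g : {linear V -> W} := HB.pack f L.
by exists (linfun g) => x; rewrite lfunE.
Qed.

Section FrameMatrix.
Variables (F : fieldType) (K : zmodType) (A : falgType F).
Variables (AG : K -> {vspace A}) (e : A).
Hypotheses (ee : e * e = e) (e_neq0 : e != 0).
Hypotheses (gradA : is_grading AG) (eG : e \in AG 0).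
Variables (k : nat) (g : 'I_k -> K) (u v : 'I_k -> A).
Hypothesis uvP : graded_frame AG e g u v.

Let AGM : forall g h, (AG g * AG h <= AG (g + h)%R)%VS.
Proof. by case: gradA. Qed.

Local Notation D := (corner_alg ee e_neq0).
Local Notation DG := (corner_grading ee e_neq0 AG).

Definition frame_matrix (a : A) : 'M[D]_k :=
  \matrix_(i, j) vsproj (corner_aspace ee e_neq0) (v i * a * u j).

Lemma val_frame_matrix a i j : vsval (frame_matrix a i j) = v i * a * u j.
Proof.
rewrite mxE vsprojK //= mem_corner -(frame_mulre uvP) -(frame_mulel uvP).
by rewrite !mulrA ee -!mulrA ee.
Qed.

Definition frame_unmatrix (B : 'M[D]_k) : A :=
  \sum_i \sum_j u i * vsval (B i j) * v j.

Lemma frame_matrixK : cancel frame_matrix frame_unmatrix.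
Proof.
move=> a; rewrite /frame_unmatrix -[RHS]mulr1 -[a in RHS]mul1r -(frame_sum1 uvP).
rewrite !mulr_suml; apply: eq_bigr => i _; rewrite mulr_sumr.
by apply: eq_bigr => j _; rewrite val_frame_matrix !mulrA.
Qed.

Lemma frame_unmatrixK : cancel frame_unmatrix frame_matrix.
Proof.
move=> B; apply/matrixP => i j; apply/subvs_inj; rewrite val_frame_matrix.
have -> : v i * frame_unmatrix B = \sum_l vsval (B i l) * v l.
  rewrite mulr_sumr (bigD1 i) //= [X in _ + X]big1 => [|l li]; last first.
    rewrite mulr_sumr big1 // => l' _.
    by rewrite !mulrA (frame_ortho uvP) eq_sym (negPf li) !mul0r.
  rewrite addr0 mulr_sumr; apply: eq_bigr => l _.
  by rewrite !mulrA (frame_ortho uvP) eqxx (corner_mull ee (subvsP _)).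
rewrite mulr_suml (bigD1 j) //= [X in _ + X]big1 => [|l lj].
  by rewrite addr0 -mulrA (frame_ortho uvP) eqxx (corner_mulr ee (subvsP _)).
by rewrite -mulrA (frame_ortho uvP) (negPf lj) mulr0.
Qed.

Lemma frame_matrix_zmod : zmod_morphism frame_matrix.
Proof.
by move=> a b; apply/matrixP => i j; rewrite !mxE mulrBr mulrBl linearB.
Qed.

Lemma frame_matrix_monoid : monoid_morphism frame_matrix.
Proof.
split=> [|a b]; apply/matrixP => i j; apply/subvs_inj.
  rewrite val_frame_matrix mulr1 (frame_ortho uvP) mxE.
  by case: eqP => _; [rewrite mulr1n val_corner1 | rewrite mulr0n].
rewrite val_frame_matrix mxE linear_sum /=.
under eq_bigr => l _ do rewrite !val_frame_matrix.
rewrite -[a in LHS]mulr1 -(frame_sum1 uvP) mulr_sumr mulr_suml mulr_sumr mulr_suml.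
by apply: eq_bigr => l _; rewrite !mulrA.
Qed.

Lemma frame_matrix_iso :
  exists psi : {rmorphism A -> 'M[D]_k},
    [/\ bijective psi,
        forall (c : F) a, psi (c *: a) = (c%:A : D) *: psi a
      & forall x a, a \in AG x <->
          forall i j, psi a i j \in DG (x - g i + g j)].
Proof.
pose Z := GRing.isZmodMorphism.Build A 'M[D]_k frame_matrix frame_matrix_zmod.
pose M := GRing.isMonoidMorphism.Build A 'M[D]_k frame_matrix frame_matrix_monoid.
pose psi : {rmorphism A -> 'M[D]_k} := HB.pack frame_matrix Z M.
exists psi; split.
- by exists frame_unmatrix; [apply: frame_matrixK | apply: frame_unmatrixK].
- move=> c a; apply/matrixP => i j; apply/subvs_inj.
  rewrite val_frame_matrix mxE -scalerAl mul1r /= val_frame_matrix.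
  by rewrite -scalerAr -scalerAl.
- move=> x a; split=> [ax i j|axE].
  rewrite mem_corner_grading val_frame_matrix addrC [x - _]addrC.
  by rewrite addrC !(memM_graded AGM) ?(frame_degl uvP) ?(frame_degr uvP).
rewrite -[a]frame_matrixK; apply: memv_suml => i _; apply: memv_suml => j _.
have -> : x = g i + (x - g i + g j) + - g j by rewrite addrA addrK addrC subrK.
rewrite !(memM_graded AGM) ?(frame_degl uvP) ?(frame_degr uvP) //.
by rewrite -mem_corner_grading axE.
Qed.

Definition left_ideal_gen : {vspace A} := lker (amulr e - \1)%VF.

Lemma mem_left_ideal_gen x : (x \in left_ideal_gen) = (x * e == x).
Proof. by rewrite memv_ker !lfun_simp /= subr_eq0. Qed.

(** U is A e, with D = e A e acting on the right and A on the left. A map f commuting with D is left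
    multiplication by the sum of the f(u_i) v_i, since x is the sum of the u_i (v_i x) with v_i x in
    D when x is in A e. *)
Lemma frame_EndD :
  exists (U : vectType F) (UG : K -> {vspace U}) (act : 'Hom(D, 'End(U)))
         (rho : 'Hom(A, 'End(U))),
    graded_rmodule DG UG act /\ graded_iso_EndD AG UG act rho.
Proof.
pose U := subvs_of left_ideal_gen; pose pr := vsproj left_ideal_gen.
pose UG g : {vspace U} := (linfun (vsval : U -> A) @^-1: AG g)%VS.
have memUG h (x : U) : (x \in UG h) = (vsval x \in AG h).
  by rewrite -memv_preim lfunE.
have Ue (x : U) : vsval x * e = vsval x.
  by apply/eqP; rewrite -mem_left_ideal_gen subvsP.
have De (d : D) : vsval d * e = vsval d /\ e * vsval d = vsval d.
  by rewrite (corner_mull ee (subvsP d)) (corner_mulr ee (subvsP d)).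
pose actf (d : D) : 'End(U) := linfun (pr \o amulr (vsval d) \o (vsval : U -> A)).
have actfE d x : vsval (actf d x) = vsval x * vsval d.
  rewrite lfunE /= lfunE /= vsprojK // mem_left_ideal_gen.
  by rewrite -mulrA (De d).1.
have [act actE] : {act : 'Hom(D, 'End(U)) | act =1 actf}.
  apply: lfun_of_linear => c d d'; apply/lfunP => x; apply/subvs_inj.
  rewrite add_lfunE scale_lfunE [RHS]linearP actfE linearP /= !actfE.
  by rewrite mulrDr scalerAr.
pose rhof (a : A) : 'End(U) := linfun (pr \o amull a \o (vsval : U -> A)).
have rhofE a x : vsval (rhof a x) = a * vsval x.
  rewrite lfunE /= lfunE /= vsprojK // mem_left_ideal_gen.
  by rewrite -mulrA Ue.
have [rho rhoE] : {rho : 'Hom(A, 'End(U)) | rho =1 rhof}.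
  apply: lfun_of_linear => c a b; apply/lfunP => x; apply/subvs_inj.
  rewrite add_lfunE scale_lfunE [RHS]linearP /= !rhofE.
  by rewrite mulrDl scalerAl.
have vact d x : vsval (act d x) = vsval x * vsval d by rewrite actE actfE.
have vrho a x : vsval (rho a x) = a * vsval x by rewrite rhoE rhofE.
have uU i : u i \in left_ideal_gen by rewrite mem_left_ideal_gen (frame_mulre uvP).
exists U, UG, act, rho; split; split.
- apply/lfunP => x; apply/subvs_inj.
  by rewrite vact id_lfunE (val_corner1 ee e_neq0) Ue.
- move=> x y; apply/lfunP => z; apply/subvs_inj.
  by rewrite comp_lfunE !vact mulrA.
- have [/direct_decompositionP[s [pi piP]] _] := gradA.
  apply/direct_decompositionP; do 2!eexists.
  apply: (subvs_direct_decomposition piP) => h x.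
  rewrite !mem_left_ideal_gen => /eqP xe; apply/eqP; rewrite -[in RHS]xe.
  by rewrite (component_mulr piP AGM _ _ eG) subr0.
- move=> h h' x d; rewrite !memUG mem_corner_grading vact => xh dh.
  exact: (memM_graded AGM).
- move=> a b ab; rewrite -[a]mulr1 -[b]mulr1 -(frame_sum1 uvP) !mulr_sumr.
  apply: eq_bigr => i _; rewrite !mulrA; congr (_ * _).
  by rewrite -[u i](vsprojK (uU i)) -!vrho ab.
- by move=> a b; apply/lfunP => x; apply/subvs_inj; rewrite comp_lfunE !vrho mulrA.
- move=> f; split=> [fD|[a ->] d]; last first.
    by apply/lfunP => x; apply/subvs_inj; rewrite !comp_lfunE !(vact, vrho) mulrA.
  exists (\sum_i vsval (f (pr (u i))) * v i); apply/lfunP => x; apply/subvs_inj.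
  rewrite vrho mulr_suml.
  have vC i : v i * vsval x \in corner_aspace ee e_neq0.
    by rewrite /= mem_corner mulrA (frame_mulel uvP) -mulrA Ue.
  rewrite {1}(_ : x = \sum_i
    act (vsproj (corner_aspace ee e_neq0) (v i * vsval x)) (pr (u i))); last first.
    apply/subvs_inj; rewrite linear_sum /= -[LHS]mul1r -(frame_sum1 uvP).
    by rewrite mulr_suml; apply: eq_bigr => i _; rewrite vact !vsprojK ?mulrA.
  rewrite !linear_sum /=; apply: eq_bigr => i _.
  have /lfunP/(_ (pr (u i))) := fD (vsproj (corner_aspace ee e_neq0) (v i * vsval x)).
  by rewrite !comp_lfunE => ->; rewrite vact vsprojK ?mulrA.
- move=> h a; split=> [ah h'|aU].
    apply/subvP=> _ /memv_imgP[x xh ->]; move: xh; rewrite !memUG vrho => xh.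
    exact: (memM_graded AGM).
  rewrite -[a]mulr1 -(frame_sum1 uvP) mulr_sumr; apply: memv_suml => i _.
  rewrite mulrA -[h](addrK (g i)) (memM_graded AGM) ?(frame_degr uvP) //.
  have /subvP/(_ (rho a (pr (u i)))) := aU (g i).
  rewrite memUG vrho vsprojK //; apply; apply: memv_img.
  by rewrite memUG vsprojK // (frame_degl uvP).
Qed.

End FrameMatrix.

(** Change of homogeneous basis: each u_i is multiplied by a homogeneous unit x_i of e A e with
    inverse y_i. *)
Lemma frame_twist (F : fieldType) (K : zmodType) (A : falgType F)
    (AG : K -> {vspace A}) (e : A) (k : nat) (g d : 'I_k -> K)
    (u v x y : 'I_k -> A) :
    is_grading AG -> graded_frame AG e g u v ->
    (forall i, x i \in AG (d i)) -> (forall i, y i \in AG (- d i)) ->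
    (forall i, [/\ e * x i = x i, x i * e = x i, e * y i = y i & y i * e = y i]) ->
    (forall i, x i * y i = e /\ y i * x i = e) ->
  graded_frame AG e (fun i => g i + d i) (fun i => u i * x i)
    (fun i => y i * v i).
Proof.
move=> [_ AGM] uvP xd yd xye xy; split=> [i|i|i|i|i j|].
- exact: (memM_graded AGM (frame_degl uvP i) (xd i)).
- by rewrite opprD addrC; apply: (memM_graded AGM (yd i) (frame_degr uvP i)).
- by have [_ xe _ _] := xye i; rewrite -mulrA xe.
- by have [_ _ ey _] := xye i; rewrite mulrA ey.
- rewrite mulrA -[_ * _ * u j]mulrA (frame_ortho uvP).
  case: eqP => [<-|_]; last by rewrite mulr0 mul0r.
  by have [_ _ _ ->] := xye i; have [_ ->] := xy i.
- rewrite -(frame_sum1 uvP); apply: eq_bigr => i _.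
  by rewrite mulrA -[_ * _ * y i]mulrA (xy i).1 (frame_mulre uvP).
Qed.

(** * Existence: odd gradings are of the form Gamma(T, beta, gamma) *)

Lemma grading_iso_refl (F : fieldType) (m n : nat) (G : zmodType)
    (Gam : G -> {vspace 'M[F]_(m.+1 + n.+1)}) : grading_iso Gam Gam.
Proof.
exists (id_ahom _); split=> [|p|g]; rewrite /= ?lim1g //.
by exists id => a; rewrite id_lfunE.
Qed.

Lemma odd_grading_is_Gamma (F : closedFieldType) (G : zmodType) (m n : nat)
    (Gam : G -> {vspace 'M[F]_(m.+1 + n.+1)}) :
    super_grading Gam -> odd_grading Gam ->
  exists (T : {fset Gsharp G}) (beta : Gsharp G -> Gsharp G -> F)
         (k : nat) (gam : k.-tuple G),
    odd_datum T beta /\ is_Gamma T beta gam Gam.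
Proof.
move=> superG oddG; have gradG := sharp_is_grading superG.
have simpA : simple_algebra 'M[F]_(m.+1 + n.+1) by apply: matrix_simple.
have [/direct_decompositionP[s [pi piP]] AGM] := gradG.
have [e eP] := primitive_homogeneous_idempotent piP AGM simpA.
have [eG e0 ee divE] := eP.
have [k [g [u [v uvP]]]] := division_idempotent_frame piP AGM simpA eP.
have divD := corner_graded_division ee e0 gradG eP.
have [T [beta [subT betaP assocT]]] :=
  graded_division_associated divD (corner_simple simpA).
exists T, beta.
(* If T has no odd element, [frame_EndD] exhibits the grading as even, against the hypothesis. *)
have [/hasP[t tT t1]|/hasPn evenT] :=
  boolP (has (fun t => t.2 != 0) (enum_fset T)); last first.
  case: oddG; have [U [UG [act [rho [actP rhoP]]]]] := frame_EndD ee e0 gradG eG uvP.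
  do 6!eexists; split; [exact: divD | exact: actP | exact: rhoP |].
  by move=> x; rewrite (assoc_supp assocT) => /evenT; rewrite negbK => /eqP.
have tE : t.2 = 1 by case: (Z2_cases t.2) t1 => ->.
have X0 : corner_grading ee e0 (sharp_grading Gam) t != 0%VS.
  by rewrite (assoc_supp assocT).
pose X := vpick (corner_grading ee e0 (sharp_grading Gam) t).
have XG : X \in corner_grading ee e0 (sharp_grading Gam) t by exact: memv_pick.
have XU : X \is a GRing.unit by apply: (divD.2 t _ XG); rewrite vpick0.
have XVG : X^-1 \in corner_grading ee e0 (sharp_grading Gam) (- t).
  by apply: graded_invr => //; rewrite vpick0.
(* Basis elements of odd degree are multiplied by the odd unit X of degree t, the others by the unit
   e. *)
pose d i : Gsharp G := if (g i).2 == 0 then 0 else t.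
pose x i := if (g i).2 == 0 then e else vsval X.
pose y i := if (g i).2 == 0 then e else vsval X^-1.
have uvP' : graded_frame (sharp_grading Gam) e (fun i => g i + d i)
    (fun i => u i * x i) (fun i => y i * v i).
  have vXG := XG; rewrite mem_corner_grading in vXG.
  have vXVG := XVG; rewrite mem_corner_grading in vXVG.
  apply: (frame_twist gradG uvP) => i; rewrite /x /y /d; case: ifP => _ //.
  - by rewrite oppr0.
  - by rewrite !(corner_mull ee (subvsP _)) !(corner_mulr ee (subvsP _)).
  - by rewrite -!val_cornerM divrr // mulVr // val_corner1.
pose gam := [tuple (g i + d i).1 | i < k].
exists k, gam; split; first by split=> //; exists t.
split=> //; exists (corner_alg ee e0), (corner_grading ee e0 (sharp_grading Gam)).
split=> //.
have [psi [bij_psi psiZ psiG]] := frame_matrix_iso ee e0 gradG uvP'.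
exists psi; split=> // z a.
have gamE i : inG (tnth gam i) = g i + d i.
  rewrite tnth_mktuple /inG [RHS]surjective_pairing; congr pair.
  rewrite /d /=; case: eqP => [->|g0]; first by rewrite addr0.
  by rewrite tE; case: (Z2_cases (g i).2) g0 => -> // _; rewrite Z2_add11.
rewrite /Mk_degree; split=> [/psiG az i j|az].
  by rewrite !gamE; apply: az.
by apply/psiG => i j; rewrite -!gamE; apply: az.
Qed.

(** * Isomorphisms of gradings *)

Section GradingIso.
Variables (F : fieldType) (m n : nat) (G : zmodType).
Local Notation Mmn := ('M[F]_(m.+1 + n.+1)).
Implicit Types Gam : G -> {vspace Mmn}.

(** Each parity part is spanned by its homogeneous elements, so a map that respects the G^#-degrees
    respects parity. *)
Lemma parity_subv Gam (p : 'Z_2) (W : {vspace Mmn}) :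
    super_grading Gam -> (forall g, (sharp_grading Gam (g, p) <= W)%VS) ->
  (parity_part F m n p <= W)%VS.
Proof.
move=> superG subW; apply/subvP => a ap.
have [/direct_decompositionP[s [pi [_ piV pi_sum _]]] _] := sharp_is_grading superG.
have sum_par q (P : pred (Gsharp G)) :
    (forall x, P x -> x.2 = q) -> \sum_(x <- s | P x) pi x a \in parity_part F m n q.
  by move=> Pq; apply: memv_suml => x /Pq <-; have /memv_capP[] := piV x a.
have aE := pi_sum a; rewrite (bigID (fun x : Gsharp G => x.2 == p)) /= in aE.
(* This sum has the other parity; being also a difference of elements of parity p, it vanishes. *)
suff odd0 : \sum_(x <- s | x.2 != p) pi x a = 0.
  rewrite -aE odd0 addr0; apply: memv_suml => -[g q] /= /eqP qp.
  by apply: (subvP (subW g)); rewrite -qp; apply: piV.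
have inp : \sum_(x <- s | x.2 != p) pi x a \in parity_part F m n p.
  have -> : \sum_(x <- s | x.2 != p) pi x a = a - \sum_(x <- s | x.2 == p) pi x a.
    by apply/eqP; rewrite eq_sym subr_eq addrC; apply/eqP/esym.
  by apply: memvB => //; apply: sum_par => x /eqP.
have inq : \sum_(x <- s | x.2 != p) pi x a \in parity_part F m n (p + 1).
  apply: sum_par => x; case: (Z2_cases p) (Z2_cases x.2) => -> [] -> //;
  by rewrite ?Z2_add11 ?add0r.
apply/eqP; rewrite -memv0 -(parity_disjoint F m n).
apply/memv_capP; move: inp inq.
by case: (Z2_cases p) => ->; rewrite ?Z2_add11 ?add0r.
Qed.

Lemma grading_iso_of_sharp Gam Gam' (phi : 'AEnd(Mmn)) :
    super_grading Gam -> super_grading Gam' -> bijective phi ->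
    (forall x a, a \in sharp_grading Gam x <-> phi a \in sharp_grading Gam' x) ->
  grading_iso Gam Gam'.
Proof.
move=> sG sG' bij_phi phiG; exists phi.
have [psi phiK psiK] := bij_phi.
have sub_par p : (phi @: parity_part F m n p <= parity_part F m n p)%VS.
  apply/subvP=> _ /memv_imgP[a ap ->].
  have : a \in (phi @^-1: parity_part F m n p)%VS.
    move: a ap; apply/subvP; apply: (parity_subv sG) => g.
    apply/subvP=> a /phiG/memv_capP[_ par]; by rewrite -memv_preim.
  by rewrite -memv_preim.
split=> // [p|g]; apply/eqP; rewrite eqEsubv ?sub_par /=.
  apply: (parity_subv sG') => g; apply/subvP=> b bg.
  rewrite -[b]psiK memv_img //; move: bg; rewrite -[b]psiK => /phiG.
  by rewrite psiK => /memv_capP[].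
apply/andP; split; apply/subvP => b.
  case/memv_imgP => a + ->.
  rewrite (sG.2 g) => /memv_addP[a0 a0g [a1 a1g ->]].
  rewrite linearD /= memvD //.
    by have /memv_capP[] := (phiG (g, 0) a0).1 a0g.
  by have /memv_capP[] := (phiG (g, 1) a1).1 a1g.
rewrite (sG'.2 g) => /memv_addP[b0 b0g [b1 b1g ->]].
have mem_img p c : c \in sharp_grading Gam' (g, p) -> c \in (phi @: Gam g)%VS.
  by rewrite -[c]psiK => /phiG/memv_capP[cg _]; apply: memv_img.
by apply: memvD; [apply: mem_img b0g | apply: mem_img b1g].
Qed.

(** The isomorphism is [psi] followed by the inverse of [psi']. *)
Lemma grading_iso_of_matrix Gam Gam' (D : falgType F)
    (DG : Gsharp G -> {vspace D}) (k : nat) (gam : k.-tuple G)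
    (psi psi' : {rmorphism Mmn -> 'M[D]_k}) :
    super_grading Gam -> super_grading Gam' ->
    bijective psi -> bijective psi' ->
    (forall (c : F) a, psi (c *: a) = (c%:A : D) *: psi a) ->
    (forall (c : F) a, psi' (c *: a) = (c%:A : D) *: psi' a) ->
    (forall x a, a \in sharp_grading Gam x <-> Mk_degree DG gam x (psi a)) ->
    (forall x a, a \in sharp_grading Gam' x <-> Mk_degree DG gam x (psi' a)) ->
  grading_iso Gam Gam'.
Proof.
move=> sG sG' [psiI psiK psiIK] [psiI' psiK' psiIK'] psiZ psiZ' psiG psiG'.
pose phi a := psiI' (psi a).
have phiE a : psi' (phi a) = psi a by rewrite /phi psiIK'.
have lin_phi : linear phi.
  move=> c a b; apply: (can_inj psiK').
  by rewrite rmorphD psiZ' !phiE rmorphD psiZ.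
have [h hE] := lfun_of_linear lin_phi.
have h_ahom : ahom_in fullv h.
  apply/ahom_inP; split=> [a b _ _|]; rewrite !hE; apply: (can_inj psiK').
    by rewrite phiE !rmorphM /= !phiE.
  by rewrite phiE !rmorph1.
apply: (@grading_iso_of_sharp _ _ (AHom h_ahom)) => //.
  exists (fun a => psiI (psi' a)) => a /=; first by rewrite hE phiE psiK.
  by apply: (can_inj psiK'); rewrite hE phiE psiIK.
by move=> x a /=; rewrite hE psiG psiG' phiE.
Qed.

Lemma is_Gamma_transport T beta k (gam : k.-tuple G) Gam Gam' :
    super_grading Gam -> grading_iso Gam Gam' ->
  is_Gamma T beta gam Gam' -> is_Gamma T beta gam Gam.
Proof.
move=> sG [phi [bij_phi phi_par phiG]] [sG' [D [DG [assocD [psi [bij_psi psiZ psiG]]]]]].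
have inj_phi : lker phi == 0%VS by apply/lker0P; apply: bij_inj.
have memphi (W : {vspace Mmn}) a : (phi a \in (phi @: W)%VS) = (a \in W).
  apply/memv_imgP/idP => [[b bW /(bij_inj bij_phi)->] //|aW]; by exists a.
split=> //; exists D, DG; split=> //.
exists (GRing.RMorphism.clone _ _ (psi \o phi) _); split=> /=.
- exact: bij_comp.
- by move=> c a; rewrite linearZ /= psiZ.
move=> x a; rewrite -psiG !memv_cap -(phiG x.1) -{2}(phi_par x.2) !memphi.
by [].
Qed.

End GradingIso.

(** * Uniqueness of the graded division algebra of (T, beta) *)

Section DivisionIso.
Variables (F : closedFieldType) (G : zmodType) (T : {fset Gsharp G}).
Variable beta : Gsharp G -> Gsharp G -> F.
Variables (D D' : falgType F) (DG : Gsharp G -> {vspace D}).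
Variable DG' : Gsharp G -> {vspace D'}.
Hypothesis bicharT : nondeg_alt_bicharacter T beta.
Hypotheses (assocD : associated_division T beta DG)
  (assocD' : associated_division T beta DG').

(* The operators [f |-> X_t f(Z_t^-1 -)] commute because the commutation     *)
(* factors of the X_t and of the Z_t cancel, so they have a common           *)
(* eigenvector, which intertwines X_t with a multiple of Z_t.                *)
Lemma division_intertwiner :
  exists f : 'Hom(D', D), f != 0 /\
    forall t, t \in T -> exists (x : D) (z : D'),
      [/\ x \in DG t, x != 0, z \in DG' t, z != 0
        & forall d, x * f d = f (z * d)].
Proof.
pose X t := vpick (DG t); pose Z t := vpick (DG' t).
have X0 t : t \in T -> X t != 0 by rewrite vpick0 (assoc_supp assocD).
have Z0 t : t \in T -> Z t != 0 by rewrite vpick0 (assoc_supp assocD').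
have XG t : X t \in DG t := memv_pick _.
have ZG t : Z t \in DG' t := memv_pick _.
have XU t : t \in T -> X t \is a GRing.unit.
  by move=> /X0; apply: (assoc_division assocD).2.
have ZU t : t \in T -> Z t \is a GRing.unit.
  by move=> /Z0; apply: (assoc_division assocD').2.
pose opf t (f : 'Hom(D', D)) : 'Hom(D', D) :=
  (amull (X t) \o f \o amull (Z t)^-1%R)%VF.
have opfE t f d : opf t f d = X t * f ((Z t)^-1 * d).
  by rewrite /opf !comp_lfunE !lfunE.
have opf_lin t : linear (opf t).
  move=> c f f'; apply/lfunP => d; rewrite add_lfunE scale_lfunE !opfE.
  by rewrite add_lfunE scale_lfunE mulrDr scalerAr.
pose op t := sval (lfun_of_linear (opf_lin t)).
have opE t f d : op t f d = X t * f ((Z t)^-1 * d).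
  by rewrite /op (svalP (lfun_of_linear (opf_lin t))) opfE.
have comm : {in enum_fset T &, forall s t, (op s \o op t = op t \o op s)%VF}.
  move=> s t sT tT; apply/lfunP => f; apply/lfunP => d.
  rewrite !comp_lfunE !opE !mulrA -!invrM ?ZU //.
  rewrite (assoc_comm assocD sT tT (XG s) (XG t)).
  rewrite (assoc_comm assocD' sT tT (ZG s) (ZG t)).
  have b0 := bichar_neq0 bicharT sT tT.
  rewrite invrZ ?unitfE ?unitrMl ?ZU //.
  by rewrite -!scalerAl linearZ /= -scalerAr scalerA mulfV // scale1r.
have [||a [f [_ f0 fE]]] := lfun_common_eigenvector (U := fullv) comm.
- by rewrite -dimv_eq0 dimvf -lt0n /dim /= muln_gt0 !FalgType_proper.
- by move=> *; apply: subvf.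
exists f; split=> // t tT; exists (X t), (a t *: Z t).
have E d : X t * f d = a t *: f (Z t * d).
  by rewrite -scale_lfunE -fE // opE mulKr ?ZU.
have a0 : a t != 0.
  apply: contraNneq f0 => a0; apply/eqP/lfunP => d; rewrite lfunE /=.
  by apply: (mulrI (XU t tT)); rewrite E a0 scale0r mulr0.
split; rewrite ?memvZ ?X0 ?XG ?ZG ?scaler_eq0 ?negb_or ?a0 ?Z0 // => d.
by rewrite E -scalerAl linearZ.
Qed.

(** The relation x f(d) = f(z d), for all d, between x in D and z in D' is compatible with sums and
    products. The intertwiner makes it total on both sides, degree by degree. It is one-to-one: x =
    0 with z nonzero would make f vanish on D' z D' = D', and symmetrically. So it is the graph of a
    graded isomorphism. *)
Lemma associated_division_iso :
  exists (phi : 'Hom(D, D')) (phi' : 'Hom(D', D)),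
    [/\ cancel phi phi', cancel phi' phi, monoid_morphism phi,
        forall t x, x \in DG t -> phi x \in DG' t
      & forall t x, x \in DG' t -> phi' x \in DG t].
Proof.
have [f [f0 fE]] := division_intertwiner.
have [[/direct_decompositionP[s [pi piP]] _] _] := assoc_division assocD.
have [[/direct_decompositionP[s' [pi' piP']] _] _] := assoc_division assocD'.
pose rel (x : D) (z : D') := forall d, x * f d = f (z * d).
have relG t x : x \in DG t -> exists2 z, z \in DG' t & rel x z.
  move=> xt; have [->|x0] := eqVneq x 0.
    by exists 0; rewrite ?mem0v // => d; rewrite !mul0r linear0.
  have tT : t \in T.
    by rewrite -(assoc_supp assocD); apply: contraNneq x0 => t0; rewrite -memv0 -t0.
  have [y [z [yt y0 zt z0 yz]]] := fE t tT.
  have [c ->] := graded_division_line (assoc_division assocD) yt y0 xt.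
  exists (c *: z); first exact: memvZ.
  by move=> d; rewrite -!scalerAl yz linearZ.
have relG' t z : z \in DG' t -> exists2 x, x \in DG t & rel x z.
  move=> zt; have [->|z0] := eqVneq z 0.
    by exists 0; rewrite ?mem0v // => d; rewrite !mul0r linear0.
  have tT : t \in T.
    by rewrite -(assoc_supp assocD'); apply: contraNneq z0 => t0; rewrite -memv0 -t0.
  have [x [y [xt x0 yt y0 xy]]] := fE t tT.
  have [c ->] := graded_division_line (assoc_division assocD') yt y0 zt.
  exists (c *: x); first exact: memvZ.
  by move=> d; rewrite -!scalerAl xy linearZ.
have relD x z y w : rel x z -> rel y w -> rel (x + y) (z + w).
  by move=> xz yw d; rewrite !mulrDl xz yw linearD.
have rel0 : rel 0 0 by move=> d; rewrite !mul0r linear0.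
have relZ c x z : rel x z -> rel (c *: x) (c *: z).
  by move=> xz d; rewrite -!scalerAl xz linearZ.
have relM x z y w : rel x z -> rel y w -> rel (x * y) (z * w).
  by move=> xz yw d; rewrite -!mulrA yw xz.
have rel1 : rel 1 1 by move=> d; rewrite !mul1r.
have tot x : exists z, rel x z.
  elim/(homogeneous_ind piP): x => [|x y [z xz] [w yw]|t x /relG[z _ xz]].
  - by exists 0.
  - by exists (z + w); apply: relD.
  - by exists z.
have tot' z : exists x, rel x z.
  elim/(homogeneous_ind piP'): z => [|x y [z xz] [w yw]|t x /relG'[z _ xz]].
  - by exists 0.
  - by exists (z + w); apply: relD.
  - by exists z.
have [d fd0] : exists d, f d != 0.
  by move: f0 => /lfunPn[d]; rewrite lfunE; exists d.
have inj z : rel 0 z -> z = 0.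
  move=> z_rel; apply: contraNeq fd0 => z0.
  suff: d \in lker f by rewrite memv_ker.
  apply: (simple_algebra_gen (assoc_simple assocD') z0) => a b.
  have [x xa] := tot' a.
  by rewrite memv_ker -mulrA -xa -z_rel mul0r mulr0.
have inj' x : rel x 0 -> x = 0.
  move=> x_rel; apply: contraNeq fd0 => x0.
  suff: 1 \in lker (amulr (f d)) by rewrite memv_ker lfunE /= mul1r.
  apply: (simple_algebra_gen (assoc_simple assocD) x0) => a b.
  have [z bz] := tot b.
  by rewrite memv_ker lfunE /= -!mulrA bz x_rel mul0r linear0 mulr0.
(* The two sides of the relation as linear maps into Hom(D', D): both are injective with the same
   image, so inverting one after the other gives the isomorphism. *)
have [al alE] : {h : 'Hom(D, 'Hom(D', D)) | h =1 fun x => (amull x \o f)%VF}.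
  apply: lfun_of_linear => c x y.
  by apply/lfunP => w; rewrite add_lfunE scale_lfunE !comp_lfunE !lfunE /= mulrDl scalerAl.
have [be beE] : {h : 'Hom(D', 'Hom(D', D)) | h =1 fun z => (f \o amull z)%VF}.
  apply: lfun_of_linear => c x y.
  apply/lfunP => w; rewrite add_lfunE scale_lfunE !comp_lfunE !lfunE /=.
  by rewrite mulrDl -scalerAl linearP.
have relE x z : rel x z <-> al x = be z.
  rewrite alE beE; split=> [xz|/lfunP xz w].
    by apply/lfunP => w; rewrite !comp_lfunE !lfunE /= xz.
  by have := xz w; rewrite !comp_lfunE !lfunE /=.
have al0 : lker al == 0%VS.
  apply/eqP/vspaceP => x; rewrite memv_ker memv0; apply/eqP/eqP => [ax|->].
    by apply: inj'; apply/relE; rewrite ax linear0.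
  exact: linear0.
have be0 : lker be == 0%VS.
  apply/eqP/vspaceP => x; rewrite memv_ker memv0; apply/eqP/eqP => [ax|->].
    by apply: inj; apply/relE; rewrite ax linear0.
  exact: linear0.
pose phi := (be^-1 \o al)%VF; pose phi' := (al^-1 \o be)%VF.
have phiE x z : rel x z -> phi x = z.
  by move=> /relE xz; rewrite comp_lfunE xz lker0_lfunK.
have phiE' x z : rel x z -> phi' z = x.
  by move=> /relE xz; rewrite comp_lfunE -xz lker0_lfunK.
exists phi, phi'; split.
- by move=> x; have [z xz] := tot x; rewrite (phiE _ _ xz) (phiE' _ _ xz).
- by move=> z; have [x xz] := tot' z; rewrite (phiE' _ _ xz) (phiE _ _ xz).
- split=> [|x y]; first exact: phiE.
  have [z xz] := tot x; have [w yw] := tot y.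
  by rewrite (phiE _ _ xz) (phiE _ _ yw); apply: phiE (relM _ _ _ _ xz yw).
- by move=> t x /relG[z zt xz]; rewrite (phiE _ _ xz).
- by move=> t z /relG'[x xt xz]; rewrite (phiE' _ _ xz).
Qed.

End DivisionIso.

(** * Twisting matrices; multisets of cosets *)

Section MatrixTwist.
Variables (F : fieldType) (D D' : falgType F).
Variables (phi : 'Hom(D, D')) (phi' : 'Hom(D', D)).
Hypotheses (phiK : cancel phi phi') (phiK' : cancel phi' phi).
Hypothesis phiM : monoid_morphism phi.
Variables (k : nat) (s : 'S_k) (y : 'I_k -> D').
Hypothesis yU : forall i, y i \is a GRing.unit.

(** Entrywise [phi], a simultaneous permutation of rows and columns, and conjugation by the diagonal
    matrix of the y_i. *)
Definition matrix_twist (B : 'M[D]_k) : 'M[D']_k :=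
  \matrix_(i, j) (y i * phi (B (s i) (s j)) * (y j)^-1).

Lemma matrix_twist_zmod : zmod_morphism matrix_twist.
Proof.
by move=> B C; apply/matrixP => i j; rewrite !mxE linearB mulrBr mulrBl.
Qed.

Lemma matrix_twist_monoid : monoid_morphism matrix_twist.
Proof.
have [phi1 phi_mul] := phiM.
split=> [|B C]; apply/matrixP => i j; rewrite !mxE.
  rewrite (inj_eq perm_inj); case: eqP => [->|_] /=.
    by rewrite phi1 mulr1 divrr.
  by rewrite linear0 mulr0 mul0r.
rewrite (reindex_inj (@perm_inj _ s)) linear_sum mulr_sumr mulr_suml /=.
apply: eq_bigr => l _; rewrite !mxE phi_mul !mulrA.
by rewrite -[_ * (y l)^-1 * y l]mulrA mulVr // mulr1.
Qed.

Lemma matrix_twist_bij : bijective matrix_twist.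
Proof.
pose inv (C : 'M[D']_k) : 'M[D]_k := \matrix_(i, j)
  phi' ((y (s^-1%g i))^-1 * C (s^-1%g i) (s^-1%g j) * y (s^-1%g j)).
exists inv => [B|C]; apply/matrixP => i j; rewrite !mxE.
  by rewrite !permKV !mulrA mulVr // mul1r -mulrA mulVr // mulr1 phiK.
by rewrite !permK phiK' !mulrA divrr // mul1r -mulrA divrr // mulr1.
Qed.

Lemma matrix_twistZ (c : F) B : matrix_twist (c%:A *: B) = c%:A *: matrix_twist B.
Proof.
apply/matrixP => i j; rewrite !mxE -!scalerAl !mul1r linearZ /=.
by rewrite -scalerAr -scalerAl.
Qed.

End MatrixTwist.

(** The unit y_i is taken of degree g_s(i) + g - g'_i, which lies in T. Conjugation then turns the
    g_s(i) into the g'_i, and the common shift g cancels between rows and columns. *)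
Lemma matrix_regrading (F : closedFieldType) (G : zmodType)
    (T : {fset Gsharp G}) (beta : Gsharp G -> Gsharp G -> F)
    (A D D' : falgType F) (AG : Gsharp G -> {vspace A})
    (DG : Gsharp G -> {vspace D}) (DG' : Gsharp G -> {vspace D'}) (k : nat)
    (gam gam' : k.-tuple G) (psi : {rmorphism A -> 'M[D]_k}) (s : 'S_k) (g : G) :
    is_subgroup T -> nondeg_alt_bicharacter T beta ->
    associated_division T beta DG -> associated_division T beta DG' ->
    bijective psi ->
    (forall (c : F) a, psi (c *: a) = (c%:A : D) *: psi a) ->
    (forall x a, a \in AG x <-> Mk_degree DG gam x (psi a)) ->
    (forall i, inG (tnth gam (s i)) + inG g - inG (tnth gam' i) \in T) ->
  exists psi' : {rmorphism A -> 'M[D']_k},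
    [/\ bijective psi',
        forall (c : F) a, psi' (c *: a) = (c%:A : D') *: psi' a
      & forall x a, a \in AG x <-> Mk_degree DG' gam' x (psi' a)].
Proof.
move=> subT betaP assocD assocD' bij_psi psiZ psiG shift.
have [phi [phi' [phiK phiK' phiM phiG phiG']]] :=
  associated_division_iso betaP assocD assocD'.
pose t i := inG (tnth gam (s i)) + inG g - inG (tnth gam' i).
pose y i := vpick (DG' (t i)).
have yG i : y i \in DG' (t i) := memv_pick _.
have y0 i : y i != 0 by rewrite vpick0 (assoc_supp assocD') shift.
have divD' := assoc_division assocD'.
have DGM := divD'.1.2.
have yU i : y i \is a GRing.unit := divD'.2 _ _ (yG i) (y0 i).
have yVG i : (y i)^-1 \in DG' (- t i) by apply: graded_invr.
pose tw := matrix_twist phi s y.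
pose Z := GRing.isZmodMorphism.Build 'M[D]_k 'M[D']_k tw (matrix_twist_zmod phi s y).
pose M := GRing.isMonoidMorphism.Build 'M[D]_k 'M[D']_k tw
  (matrix_twist_monoid phiM s yU).
pose Phi : {rmorphism 'M[D]_k -> 'M[D']_k} := HB.pack tw Z M.
exists (GRing.RMorphism.clone _ _ (Phi \o psi) _); split=> /=.
- by apply: bij_comp bij_psi; apply: (matrix_twist_bij phiK phiK').
- by move=> c a; rewrite psiZ; apply: matrix_twistZ.
move=> x a; rewrite psiG; set B := psi a.
have degE i j : t i + (x - inG (tnth gam (s i)) + inG (tnth gam (s j))) - t j
    = x - inG (tnth gam' i) + inG (tnth gam' j).
  rewrite /t !opprD opprK !addrA addrK.
  by rewrite [LHS](ACl (4*3*7*1*5*2*6)) /= !addrK.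
split=> [BG i j|BG i j].
  rewrite mxE -degE; apply: (memM_graded DGM (memM_graded DGM (yG i) _) (yVG j)).
  exact/phiG/BG.
have := BG (s^-1 i)%g (s^-1 j)%g; rewrite mxE -degE !permKV => BG'.
have := memM_graded DGM (memM_graded DGM (yVG (s^-1 i)%g) BG') (yG (s^-1 j)%g).
rewrite !mulrA mulVr // mul1r -mulrA mulVr // mulr1 -addrA subrK addKr => /phiG'.
by rewrite phiK.
Qed.

Section Multisets.
Variables (G : zmodType) (T : {fset Gsharp G}).
Hypothesis subT : is_subgroup T.

Lemma translateD x y (C : {fset Gsharp G}) :
  translate x (translate y C) = translate (x + y) C.
Proof.
apply/fsetP => z; apply/imfsetP/imfsetP => /= -[c].
  by case/imfsetP => /= d dC -> ->; exists d; rewrite ?addrA.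
by move=> cC ->; exists (y + c); rewrite ?addrA //; apply/imfsetP; exists c.
Qed.

Lemma mem_translate x y : (y \in translate x T) = (y - x \in T).
Proof.
apply/imfsetP/idP => /= [[c cT ->]|yT]; first by rewrite addrC addKr.
by exists (y - x); rewrite // addrC subrK.
Qed.

Lemma subgroupDr x t : t \in T -> (x + t \in T) = (x \in T).
Proof.
have [T0 TB] := subT => tT; have tN : - t \in T by rewrite -sub0r TB.
apply/idP/idP => xT; first by rewrite -(addrK t x) TB.
by rewrite -[t]opprK TB.
Qed.

Lemma eq_translate x y : (translate x T == translate y T) = (x - y \in T).
Proof.
apply/eqP/idP => [/fsetP/(_ x)|xyT].
  by rewrite !mem_translate subrr; have [-> _] := subT => <-.
apply/fsetP => z; rewrite !mem_translate -(subgroupDr (z - x) xyT).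
by rewrite addrA subrK.
Qed.

Lemma translate_XiE g (k k' : nat) (gam : k.-tuple G) (gam' : k'.-tuple G) :
  translate_mset g (Xi T gam) = Xi T gam' <->
  perm_eq [seq translate (inG g + inG h) T | h <- gam]
          [seq translate (inG h) T | h <- gam'].
Proof.
rewrite /translate_mset /Xi.
have -> : [seq translate (inG g + inG h) T | h <- gam] =
    [seq translate (inG g) C | C <- [seq translate (inG h) T | h <- gam]].
  by rewrite -map_comp; apply: eq_map => h /=; rewrite translateD.
have p := perm_map (translate (inG g))
  (perm_eq_seq_mset [seq translate (inG h) T | h <- gam]).
split=> [/eq_seq_msetP|pe]; first by rewrite (permPl p).
by apply/eq_seq_msetP; rewrite (permPl p).
Qed.

End Multisets.

Lemma Gamma_iso_of_Xi (F : closedFieldType) (G : zmodType) (m n : nat)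
    (T : {fset Gsharp G}) (beta beta' : Gsharp G -> Gsharp G -> F) (k k' : nat)
    (gam : k.-tuple G) (gam' : k'.-tuple G)
    (Gam Gam' : G -> {vspace 'M[F]_(m.+1 + n.+1)}) (g : G) :
    is_subgroup T -> nondeg_alt_bicharacter T beta ->
    {in T &, beta =2 beta'} ->
    is_Gamma T beta gam Gam -> is_Gamma T beta' gam' Gam' ->
    translate_mset g (Xi T gam) = Xi T gam' ->
  grading_iso Gam Gam'.
Proof.
move=> subT betaP eq_beta [sG [D [DG [assocD [psi [bij_psi psiZ psiG]]]]]].
move=> [sG' [D' [DG' [assocD' [psi' [bij_psi' psiZ' psiG']]]]]].
move/translate_XiE => perm_gam.
have kk : k' = k by have := perm_size perm_gam; rewrite !size_map !size_tuple.
subst k'.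
have assocD'2 : associated_division T beta DG'.
  case: assocD' => divD' simpD' suppD' dimD' commD'; split=> // u v uT vT x y xu yv.
  by rewrite eq_beta //; apply: commD'.
have [s sE] : exists s : 'S_k, forall i,
    inG (tnth gam (s i)) + inG g - inG (tnth gam' i) \in T.
  rewrite perm_sym in perm_gam.
  have /tuple_permP[s sE] : perm_eq [seq translate (inG h) T | h <- gam']
    (map_tuple (fun h => translate (inG g + inG h) T) gam) by [].
  exists s => i; rewrite -eq_translate // addrC.
  have : tnth (map_tuple (fun h => translate (inG h) T) gam') i =
      tnth [tuple tnth (map_tuple (fun h => translate (inG g + inG h) T) gam)
        (s i) | i < k] i.
    by congr (tnth _ i); apply: val_inj.
  by rewrite tnth_mktuple !tnth_map => ->.
have [psi2 [bij_psi2 psiZ2 psiG2]] :=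
  matrix_regrading subT betaP assocD assocD'2 bij_psi psiZ psiG sE.
exact: (grading_iso_of_matrix sG sG' bij_psi2 bij_psi' psiZ2 psiZ' psiG2 psiG').
Qed.

(** * Frames of matrix gradings; invariants *)

Section SingleEntry.
Variables (D : nzRingType) (k : nat).

Definition single_mx (i j : 'I_k) (d : D) : 'M[D]_k :=
  \matrix_(a, b) if (a == i) && (b == j) then d else 0.

Lemma single_mxM i j j' l d d' :
  single_mx i j d * single_mx j' l d' =
  if j == j' then single_mx i l (d * d') else 0.
Proof.
apply/matrixP => a b; rewrite mxE (bigD1 j) //= big1 => [|c cj]; last first.
  by rewrite !mxE (negPf cj) andbF mul0r.
rewrite addr0 !mxE eqxx andbT.
case: (j =P j') => _; rewrite !mxE ?mulr0 //=.
by case: (a == i); case: (b == l); rewrite ?(mul0r, mulr0).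
Qed.

Lemma single_mx_mul i j (B : 'M[D]_k) p q :
  single_mx i p 1 * B * single_mx q j 1 = single_mx i j (B p q).
Proof.
apply/matrixP => a b; rewrite mxE (bigD1 q) //= big1 => [|c cq]; last first.
  by rewrite !mxE (negPf cq) mulr0.
rewrite addr0 !mxE (bigD1 p) //= big1 => [|c cp]; last first.
  by rewrite !mxE (negPf cp) andbF mul0r.
rewrite addr0 !mxE !eqxx andbT.
by case: (a == i); case: (b == j); rewrite ?(mul0r, mulr0, mulr1, mul1r).
Qed.

Lemma sum_single_mx : \sum_i single_mx i i 1 = 1.
Proof.
apply/matrixP => a b; rewrite summxE mxE (bigD1 a) //= big1 => [|c ca].
  by rewrite mxE eqxx addr0 eq_sym; case: eqP.
by rewrite mxE eq_sym (negPf ca).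
Qed.

End SingleEntry.

Section MatrixFrame.
Variables (F : closedFieldType) (G : zmodType) (A D : falgType F).
Variables (AG : Gsharp G -> {vspace A}) (DG : Gsharp G -> {vspace D}) (k : nat).
Variables (gam : k.-tuple G) (psi : {rmorphism A -> 'M[D]_k}).
Hypothesis divD : graded_division DG.
Hypothesis bij_psi : bijective psi.
Hypothesis psiZ : forall (c : F) a, psi (c *: a) = (c%:A : D) *: psi a.
Hypothesis psiG : forall x a, a \in AG x <-> Mk_degree DG gam x (psi a).

Local Notation deg i := (inG (tnth gam i)).

(** e is the diagonal matrix unit at i0, framed by the column E_(i,i0) and the row E_(i0,i); [j]
    identifies D with the corner, degrees included. *)
Lemma matrix_frame (i0 : 'I_k) :
  exists (e : A) (u v : 'I_k -> A) (j : 'Hom(D, A)),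
    [/\ division_idempotent AG e, graded_frame AG e (fun i => deg i - deg i0) u v,
        injective j, {morph j : x y / x * y}
      & forall t x, (x \in AG t :&: corner e)%VS <-> exists2 d, d \in DG t & x = j d].
Proof.
have [inv psiK invK] := bij_psi.
have D1 : 1 \in DG 0.
  have [/direct_decompositionP[s [pi piP]] DGM] := divD.1.
  exact: one_graded piP DGM.
pose E i l d := inv (single_mx i l d).
have psiE i l d : psi (E i l d) = single_mx i l d := invK _.
have EG i l d t : d \in DG t -> E i l d \in AG (deg i - deg l + t).
  move=> dt; apply/psiG => a b; rewrite psiE mxE; case: ifP => [/andP[/eqP-> /eqP->]|_].
    by rewrite (ACl (3*2*5*1*4)) /= subrK addrK.
  exact: mem0v.
have EM i l l' p d d' : E i l d * E l' p d' = if l == l' then E i p (d * d') else 0.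
  apply: (can_inj psiK); rewrite rmorphM !psiE single_mxM.
  by case: eqP => _; rewrite ?psiE ?rmorph0.
have j_lin : linear (E i0 i0).
  move=> c d d'; apply: (can_inj psiK); rewrite rmorphD psiZ !psiE.
  apply/matrixP => a b; rewrite !mxE; case: ifP => _; rewrite ?mulr0 ?addr0 //.
  by rewrite -scalerAl mul1r.
have [j jE] := lfun_of_linear j_lin.
pose e := E i0 i0 1.
have ee : e * e = e by rewrite /e EM eqxx mulr1.
have j_inj : injective j.
  move=> d d'; rewrite !jE => /(congr1 psi); rewrite !psiE => /matrixP/(_ i0 i0).
  by rewrite !mxE !eqxx.
have jM : {morph j : x y / x * y} by move=> x y; rewrite !jE EM eqxx.
have j1 : j 1 = e by rewrite jE.
have jG t d : d \in DG t -> j d \in AG t.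
  by move=> /(EG i0 i0); rewrite subrr add0r jE.
have j_corner d : j d \in corner e.
  by rewrite mem_corner -j1 -!jM mulr1 mul1r.
have cornerE x : x \in corner e -> x = j (psi x i0 i0).
  rewrite mem_corner => /eqP xe; apply: (can_inj psiK); rewrite -{1}xe !rmorphM /=.
  by rewrite !psiE single_mx_mul jE psiE.
have jP t x : (x \in AG t :&: corner e)%VS <-> exists2 d, d \in DG t & x = j d.
  split=> [/memv_capP[xt /cornerE xj]|[d dt ->]]; last first.
    by apply/memv_capP; split; [apply: jG | apply: j_corner].
  exists (psi x i0 i0) => //.
  have /psiG/(_ i0 i0) := xt; by rewrite subrK.
have e0 : e != 0.
  apply/eqP => e_0; have /eqP : (1 : D) = 0 by apply: j_inj; rewrite j1 linear0.
  by rewrite oner_eq0.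
exists e, (fun i => E i i0 1), (fun i => E i0 i 1), j; split=> //.
  split=> // [|g x xg x0 xe]; first by rewrite -j1 jG.
  have /jP[d dg xE] : (x \in AG g :&: corner e)%VS.
    by rewrite memv_cap xg mem_corner xe eqxx.
  have d0 : d != 0 by apply: contraNneq x0 => d0; rewrite xE d0 linear0.
  have dU := divD.2 _ _ dg d0.
  exists (j d^-1); rewrite jG ?graded_invr // xE -!jM divrr // mulVr // j1; split=> //.
  by apply/eqP; rewrite -mem_corner.
split=> [i|i|i|i|i l|].
- by have := EG i i0 _ _ D1; rewrite addr0.
- by have := EG i0 i _ _ D1; rewrite addr0 opprB.
- by rewrite /e EM eqxx mulr1.
- by rewrite /e EM eqxx mulr1.
- by rewrite /e EM mulr1.
- apply: (can_inj psiK); rewrite rmorph_sum rmorph1 -sum_single_mx.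
  by apply: eq_bigr => i _; rewrite /= EM eqxx mulr1 psiE.
Qed.

End MatrixFrame.

(** * Equivalence of homogeneous idempotents and its dimension invariants *)

Section Links.
Variables (F : fieldType) (K : zmodType) (A : falgType F).
Variable AG : K -> {vspace A}.
Hypothesis gradA : is_grading AG.

Let AGM : forall g h, (AG g * AG h <= AG (g + h)%R)%VS.
Proof. by case: gradA. Qed.

(** Homogeneous Murray-von Neumann equivalence: right multiplication by a is an isomorphism from A e
    to A e' raising degrees by c. *)
Record idempotent_link (e e' : A) (c : K) (a b : A) : Prop := IdempotentLink {
  link_degl : a \in AG c;
  link_degr : b \in AG (- c);
  link_ab : a * b = e;
  link_ba : b * a = e';
  link_ea : e * a = a;
  link_ae : a * e' = a;
  link_eb : e' * b = b;
  link_be : b * e = b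
}.

Lemma idempotent_link_sym e e' c a b :
  idempotent_link e e' c a b -> idempotent_link e' e (- c) b a.
Proof. by case=> *; split; rewrite ?opprK. Qed.

(** As the u_j v_j sum to 1, some a = e u_j is nonzero, and so is some v_i a, which is then
    invertible in e' A e'; this gives b with b a = e'. Now a b is a nonzero idempotent of the graded
    division algebra e A e, so it is e. *)
Lemma division_idempotent_link e e' k (h : 'I_k -> K) (u v : 'I_k -> A) :
    division_idempotent AG e -> division_idempotent AG e' ->
    graded_frame AG e' h u v ->
  exists c a b, idempotent_link e e' c a b.
Proof.
move=> [eG e0 ee divE] [eG' e0' ee' divE'] uvP.
have nz_sum (f : 'I_k -> A) : \sum_i f i != 0 -> exists i, f i != 0.
  move=> nz; apply: NNPP => no; case/negP: nz; rewrite big1 // => i _.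
  by apply/eqP/negPn/negP => fi; apply: no; exists i.
have [j aj0] : exists j, e * u j * v j != 0.
  apply: nz_sum; under eq_bigr do rewrite -mulrA.
  by rewrite -mulr_sumr (frame_sum1 uvP) mulr1.
have [a aE] : exists a, a = e * u j by exists (e * u j).
have a0 : a != 0 by rewrite aE; apply: contraNneq aj0 => ->; rewrite mul0r.
have ea : e * a = a by rewrite aE mulrA ee.
have ae : a * e' = a by rewrite aE -mulrA (frame_mulre uvP).
have aG : a \in AG (h j) by rewrite aE -[h j]add0r (memM_graded AGM) ?(frame_degl uvP).
have [i via] : exists i, u i * (v i * a) != 0.
  apply: nz_sum; under eq_bigr do rewrite mulrA.
  by rewrite -mulr_suml (frame_sum1 uvP) mul1r.
have va0 : v i * a != 0 by apply: contraNneq via => ->; rewrite mulr0.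
have vaG := memM_graded AGM (frame_degr uvP i) aG.
have [|y [yG eye y_inv _]] := divE' _ _ vaG va0.
  by rewrite mulrA (frame_mulel uvP) -mulrA ae.
have ey : e' * y = y by rewrite -eye !mulrA ee'.
pose b := y * v i * e.
have bG : b \in AG (- h j).
  have -> : - h j = - (- h i + h j) - h i + 0.
    by rewrite opprD opprK addr0 addrAC subrr add0r.
  by rewrite !(memM_graded AGM) ?(frame_degr uvP).
have ba : b * a = e' by rewrite /b -mulrA ea -mulrA y_inv.
have be : b * e = b by rewrite /b -mulrA ee.
have eb : e' * b = b by rewrite /b !mulrA ey.
have abG : a * b \in AG 0 by rewrite -(subrr (h j)) (memM_graded AGM).
have ab0 : a * b != 0.
  apply: contraNneq e0' => ab; rewrite -ee' -{1}ba -ba -mulrA [a * _]mulrA ab.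
  by rewrite mul0r mulr0.
have [|z [_ _ zab _]] := divE _ _ abG ab0.
  by rewrite mulrA ea -mulrA be.
exists (h j), a, b; split=> //.
have pp : a * b * (a * b) = a * b by rewrite mulrA -[a * b * a]mulrA ba ae.
have ep : e * (a * b) = a * b by rewrite mulrA ea.
by rewrite -[LHS]ep -zab -[LHS]mulrA pp.
Qed.

(** The map x -> b x a preserves degrees, and y -> a y b undoes it on e A e. *)
Lemma link_dim_corner_le e e' c a b t : e * e = e -> e' * e' = e' ->
    idempotent_link e e' c a b ->
  (\dim (AG t :&: corner e) <= \dim (AG t :&: corner e'))%N.
Proof.
move=> ee ee' ab.
pose f := (amull b \o amulr a)%VF.
have fE x : f x = b * (x * a) by rewrite comp_lfunE !lfunE.
rewrite -(limg_dim_eq (f := f)); last first.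
  apply/eqP; rewrite -subv0; apply/subvP => x /memv_capP[/memv_capP[_ xe]].
  rewrite memv_ker memv0 fE => /eqP bxa; move: xe; rewrite mem_corner => /eqP <-.
  rewrite -(link_ab ab); have -> : a * b * x * (a * b) = a * (b * (x * a)) * b.
    by rewrite !mulrA.
  by rewrite bxa mulr0 mul0r.
apply/dimvS/subvP => _ /memv_imgP[x /memv_capP[xt _] ->]; rewrite fE memv_cap.
apply/andP; split; last first.
  rewrite mem_corner mulrA (link_eb ab) -!mulrA (link_ae ab) //.
have -> : t = - c + (t + c) by rewrite addrC addrK.
rewrite (memM_graded AGM) ?(link_degr ab) // (memM_graded AGM) ?(link_degl ab) //.
Qed.

Lemma link_dim_left_ideal_le e e' c a b x : idempotent_link e e' c a b ->
  (\dim (AG x :&: left_ideal_gen e) <= \dim (AG (x + c)%R :&: left_ideal_gen e'))%N.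
Proof.
move=> ab; rewrite -(limg_dim_eq (f := amulr a)); last first.
  apply/eqP; rewrite -subv0; apply/subvP => z /memv_capP[/memv_capP[_ ze]].
  rewrite memv_ker memv0 lfunE /= => /eqP za; move: ze; rewrite mem_left_ideal_gen.
  by move=> /eqP <-; rewrite -(link_ab ab) mulrA za mul0r.
apply/dimvS/subvP => _ /memv_imgP[z /memv_capP[zx _] ->]; rewrite lfunE /=.
rewrite memv_cap mem_left_ideal_gen -mulrA (link_ae ab) eqxx andbT.
exact: (memM_graded AGM zx (link_degl ab)).
Qed.

Lemma link_dim_corner e e' c a b t : e * e = e -> e' * e' = e' ->
    idempotent_link e e' c a b ->
  \dim (AG t :&: corner e) = \dim (AG t :&: corner e').
Proof.
move=> ee ee' ab; apply/eqP; rewrite eqn_leq (link_dim_corner_le t ee ee' ab).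
exact: link_dim_corner_le t ee' ee (idempotent_link_sym ab).
Qed.

Lemma link_dim_left_ideal e e' c a b x : idempotent_link e e' c a b ->
  \dim (AG x :&: left_ideal_gen e) = \dim (AG (x + c)%R :&: left_ideal_gen e').
Proof.
move=> ab; apply/eqP; rewrite eqn_leq (link_dim_left_ideal_le x ab) -{2}(addrK c x).
exact: link_dim_left_ideal_le (idempotent_link_sym ab).
Qed.

(** A e is the direct sum of the u_i e A e, with left multiplication by u_i v_i as the i-th
    projection. *)
Lemma frame_dim e k (h : 'I_k -> K) (u v : 'I_k -> A) x :
    e * e = e -> graded_frame AG e h u v ->
  \dim (AG x :&: left_ideal_gen e) = (\sum_i \dim (AG (x - h i)%R :&: corner e))%N.
Proof.
move=> ee uvP.
pose W i := (amull (u i) @: (AG (x - h i)%R :&: corner e))%VS.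
have W_dim i : \dim (W i) = \dim (AG (x - h i)%R :&: corner e).
  apply: limg_dim_eq; apply/eqP; rewrite -subv0; apply/subvP => d.
  case/memv_capP=> /memv_capP[_ /(corner_mull ee) ed]; rewrite memv_ker memv0 lfunE /=.
  move=> /eqP ud; have := frame_ortho uvP i i; rewrite eqxx => vu.
  by rewrite -ed -vu -mulrA ud mulr0.
under eq_bigr do rewrite -W_dim.
have dirW : directv (\sum_(i <- index_enum 'I_k) W i).
  apply: (directv_of_projections (pi := fun i => amull (u i * v i))).
    exact: index_enum_uniq.
  move=> i j _ /memv_imgP[d /memv_capP[_ /(corner_mull ee) ed] ->].
  rewrite !lfunE /= mulrA -[u i * v i * u j]mulrA (frame_ortho uvP).
  by case: eqP => [->|_]; rewrite ?mulr0 ?mul0r // -mulrA ed.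
rewrite directvE /= in dirW; rewrite -(eqP dirW); congr (\dim _).
apply/eqP; rewrite eqEsubv; apply/andP; split; apply/subvP => z.
  case/memv_capP=> zx; rewrite mem_left_ideal_gen => /eqP ze.
  rewrite -[z]mul1r -(frame_sum1 uvP) mulr_suml.
  apply: memv_sumr => i _; apply/memv_imgP.
  exists (v i * z); last by rewrite lfunE /= mulrA.
  rewrite memv_cap addrC (memM_graded AGM) ?(frame_degr uvP) //=.
  by rewrite mem_corner mulrA (frame_mulel uvP) -mulrA ze.
move: z; apply/subvP/subv_sumP => i _; apply/subvP => _ /memv_imgP[d dP ->].
case/memv_capP: dP => dx /(corner_mulr ee) de.
rewrite lfunE /= memv_cap mem_left_ideal_gen -mulrA de eqxx andbT.
have -> : x = h i + (x - h i) by rewrite addrC subrK.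
by rewrite (memM_graded AGM) ?(frame_degl uvP).
Qed.

End Links.

(** * Invariance of T, beta and the multiset of cosets *)

Section Uniqueness.
Variables (F : closedFieldType) (m n : nat) (G : zmodType).
Local Notation Mmn := ('M[F]_(m.+1 + n.+1)).

(** Expresses the presentation inside M(m,n), so that two presentations of one grading can be
    compared; [x0] is the degree attached to the base index. *)
Lemma is_Gamma_frame (T : {fset Gsharp G}) (beta : Gsharp G -> Gsharp G -> F)
    (k : nat) (gam : k.-tuple G) (Gam : G -> {vspace Mmn}) :
    is_Gamma T beta gam Gam ->
  exists (e : Mmn) (u v : 'I_k -> Mmn) (x0 : Gsharp G),
    [/\ division_idempotent (sharp_grading Gam) e,
        graded_frame (sharp_grading Gam) e
          (fun i => inG (tnth gam i) - x0) u v,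
        forall t, \dim (sharp_grading Gam t :&: corner e) = (t \in T)
      & {in T &, forall s t x y,
          x \in (sharp_grading Gam s :&: corner e)%VS ->
          y \in (sharp_grading Gam t :&: corner e)%VS ->
          x * y = beta s t *: (y * x)}].
Proof.
move=> [sG [D [DG [assocD [psi [bij_psi psiZ psiG]]]]]].
have [i0] : exists i0 : 'I_k, True.
  apply: NNPP => no; have /eqP : (1 : Mmn) = 0.
    by apply: (bij_inj bij_psi); apply/matrixP => i; case: no; exists i.
  by rewrite oner_eq0.
have [e [u [v [j [eP uvP j_inj jM jP]]]]] :=
  matrix_frame (assoc_division assocD) bij_psi psiZ psiG i0.
move=> _; exists e, u, v, (inG (tnth gam i0)); split=> // [t|s t sT tT x y].
  have -> : (sharp_grading Gam t :&: corner e)%VS = (j @: DG t)%VS.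
    apply/vspaceP => x; apply/idP/memv_imgP => [/jP[d dt ->]|[d dt ->]].
      by exists d.
    by apply/jP; exists d.
  rewrite limg_dim_eq; last first.
    have /eqP-> : lker j == 0%VS by apply/lker0P.
    exact: capv0.
  have := assoc_supp assocD t; case: (boolP (t \in T)) => [tT _|_].
    exact: assoc_dim assocD t tT.
  by move/negbT; rewrite negbK => /eqP->; rewrite dimv0.
move=> /jP[d ds ->] /jP[d' dt ->].
by rewrite -!jM (assoc_comm assocD sT tT ds dt) linearZ.
Qed.

(** T is the support of e R e and beta its commutation factor, both carried to e' R e' by x -> b x
    a. Dimensions of components of R e and R e' count multiplicities of cosets. *)
Lemma is_Gamma_unique (T T' : {fset Gsharp G})
    (beta beta' : Gsharp G -> Gsharp G -> F)
    (k k' : nat) (gam : k.-tuple G) (gam' : k'.-tuple G) (Gam : G -> {vspace Mmn}) :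
    odd_datum T beta ->
    is_Gamma T beta gam Gam -> is_Gamma T' beta' gam' Gam ->
  [/\ T = T', {in T &, beta =2 beta'}
    & exists g : G, translate_mset g (Xi T gam) = Xi T' gam'].
Proof.
move=> [subT [t0 t0T t0_odd] _] GamT GamT'.
have gradG : is_grading (sharp_grading Gam) by apply: sharp_is_grading; case: GamT.
have [e [u [v [x0 [eP uvP dimT commT]]]]] := is_Gamma_frame GamT.
have [e' [u' [v' [x0' [eP' uvP' dimT' commT']]]]] := is_Gamma_frame GamT'.
have [c [a [b ab]]] := division_idempotent_link gradG eP eP' uvP'.
have ee : e * e = e by case: eP. have ee' : e' * e' = e' by case: eP'.
have eqT : T = T'.
  apply/fsetP => t; have := link_dim_corner gradG t ee ee' ab.
  by rewrite dimT dimT'; case: (t \in T); case: (t \in T').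
subst T'.
have corner_mem t x : x \in (sharp_grading Gam t :&: corner e)%VS ->
    b * x * a \in (sharp_grading Gam t :&: corner e')%VS.
  move=> /memv_capP[xt _]; rewrite memv_cap; apply/andP; split.
    have -> : t = - c + t + c by rewrite [RHS]addrC addrA subrr add0r.
    by rewrite !(memM_graded gradG.2) ?(link_degr ab) ?(link_degl ab).
  by rewrite mem_corner !mulrA (link_eb ab) -!mulrA (link_ae ab).
have mulE x y : x * e = x -> b * x * a * (b * y * a) = b * (x * y) * a.
  move=> xe; rewrite !mulrA -[b * x * a * b]mulrA (link_ab ab).
  by rewrite -[b * x * e]mulrA xe.
split=> // [s t sT tT|].
  have nzE r : r \in T -> exists2 x,
      x \in (sharp_grading Gam r :&: corner e)%VS & x != 0.
    move=> rT; exists (vpick (sharp_grading Gam r :&: corner e)%VS).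
      exact: memv_pick.
    by rewrite vpick0 -dimv_eq0 dimT rT.
  have [x xs x0n] := nzE s sT; have [y yt y0n] := nzE t tT.
  have xe : x * e = x by case/memv_capP: xs => _ /(corner_mulr ee).
  have ye : y * e = y by case/memv_capP: yt => _ /(corner_mulr ee).
  have [_ [_ _ _ divE]] := (isT, eP).
  have yx0 : y * x != 0.
    apply: contraNneq x0n => yx; have /memv_capP[yG ye'] := yt.
    have [|y' [_ _ y'y _]] := divE t y yG y0n; first by apply/eqP; rewrite -mem_corner.
    case/memv_capP: xs => _ /(corner_mull ee) <-.
    by rewrite -y'y -mulrA yx mulr0.
  have := commT' s t sT tT _ _ (corner_mem _ _ xs) (corner_mem _ _ yt).
  rewrite !mulE // (commT s t sT tT x y xs yt) => bE.
  have {bE} : beta s t *: (y * x) = beta' s t *: (y * x).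
    have conjE z : e * z = z -> z * e = z -> a * (b * z * a) * b = z.
      by move=> ez ze; rewrite !mulrA (link_ab ab) ez -mulrA (link_ab ab) ze.
    have ey : e * y = y by case/memv_capP: yt => _ /(corner_mull ee).
    have yxE : a * (b * (y * x) * a) * b = y * x.
      by apply: conjE; rewrite ?mulrA ?ey // -mulrA xe.
    have := congr1 (fun z => a * z * b) bE.
    by rewrite -!scalerAr -!scalerAl -!scalerAr -!scalerAl yxE.
  by move/eqP; rewrite -subr_eq0 -scalerBl scaler_eq0 (negPf yx0) orbF subr_eq0 => /eqP.
pose d := c + x0' - x0.
(* The shift [d] may be odd; adding an odd element of T stays in its coset and lands in G. *)
have [t tT dt] : exists2 t, t \in T & (d + t).2 = 0.
  case: (Z2_cases d.2) => d2.
    by exists 0; rewrite ?addr0 //; case: subT.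
  exists t0 => //=; move: d2 t0_odd => /= ->.
  by case: (Z2_cases t0.2) => -> //; rewrite Z2_add11.
exists (d + t).1; apply/translate_XiE.
have gE : inG (d + t).1 = d + t by rewrite [RHS]surjective_pairing dt.
have countE (k1 : nat) (gam1 : k1.-tuple G) z y :
    count_mem (translate y T) [seq translate (z + inG h) T | h <- gam1] =
    (\sum_i ((y - z - inG (tnth gam1 i))%R \in T))%N.
  rewrite count_map -sum1_count big_tuple big_mkcond /=; apply: eq_bigr => i _.
  by rewrite eq_sym eq_translate // opprD addrA; case: ifP.
have countE' y : count_mem (translate y T) [seq translate (inG h) T | h <- gam'] =
    (\sum_i ((y - inG (tnth gam' i))%R \in T))%N.
  have -> : [seq translate (inG h) T | h <- gam'] =
      [seq translate (0 + inG h) T | h <- gam'].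
    by apply: eq_map => h; rewrite add0r.
  by rewrite countE subr0.
have eq_count y : count_mem (translate y T)
      [seq translate (inG (d + t).1 + inG h) T | h <- gam] =
    count_mem (translate y T) [seq translate (inG h) T | h <- gam'].
  rewrite countE countE' gE.
  (* In this degree the dimension for R e counts the g_i in y - d + T, and the one for R e' counts
     the g'_i in y + T. *)
  have := link_dim_left_ideal gradG (y - d - x0) ab.
  rewrite (frame_dim gradG _ ee uvP) (frame_dim gradG _ ee' uvP').
  under eq_bigr do rewrite dimT.
  under [in RHS]eq_bigr do rewrite dimT'.
  move=> H; transitivity (\sum_i ((y - d - x0 - (inG (tnth gam i) - x0))%R \in T))%N.
    apply: eq_bigr => i _; congr (nat_of_bool _).
    have -> : y - d - x0 - (inG (tnth gam i) - x0) = y - (d + t) - inG (tnth gam i) + t.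
      rewrite !opprD opprK !addrA.
      by rewrite [LHS](ACl (1*2*4*5*3)) [RHS](ACl (1*2*4*5*3)) /= !addrK.
    by rewrite (subgroupDr subT _ tT).
  rewrite H; apply: eq_bigr => i _; congr (nat_of_bool _).
  have -> : y - d - x0 + c - (inG (tnth gam' i) - x0') = y - inG (tnth gam' i).
    rewrite /d !opprD !opprK !addrA.
    by rewrite [LHS](ACl (1*7*4*5*6*2*8*3)) /= !addrK.
  by [].
(* Multiplicities need comparing only at entries of the two lists, and all of these are cosets of
   T. *)
apply/allP => C; rewrite mem_cat => /orP[] /mapP[h _ ->] /=; apply/eqP.
  exact: eq_count.
exact: eq_count.
Qed.

End Uniqueness.

Theorem theorem4p6 (F : closedFieldType) (G : zmodType) (m n : nat) :
  (forall Gam : G -> {vspace 'M[F]_(m.+1 + n.+1)},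
      super_grading Gam -> odd_grading Gam ->
      exists (T : {fset Gsharp G}) (beta : Gsharp G -> Gsharp G -> F)
             (k : nat) (gam : k.-tuple G)
             (Gam' : G -> {vspace 'M[F]_(m.+1 + n.+1)}),
        [/\ odd_datum T beta, is_Gamma T beta gam Gam' & grading_iso Gam Gam'])
  /\
  (forall (T T' : {fset Gsharp G}) (beta beta' : Gsharp G -> Gsharp G -> F)
          (k k' : nat) (gam : k.-tuple G) (gam' : k'.-tuple G)
          (Gam Gam' : G -> {vspace 'M[F]_(m.+1 + n.+1)}),
      odd_datum T beta -> odd_datum T' beta' ->
      is_Gamma T beta gam Gam -> is_Gamma T' beta' gam' Gam' ->
      (grading_iso Gam Gam' <->
       [/\ T = T', {in T &, beta =2 beta'}
         & exists g : G, translate_mset g (Xi T gam) = Xi T' gam'])).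
Proof.
split=> [Gam sG oddG|T T' beta beta' k k' gam gam' Gam Gam' oddT oddT' GamT GamT'].
  have [T [beta [k [gam [oddT GamT]]]]] := odd_grading_is_Gamma sG oddG.
  by exists T, beta, k, gam, Gam; split=> //; apply: grading_iso_refl.
split=> [iso|[eqT eq_beta [g Xi_g]]].
  (* Pull the second presentation back along the isomorphism, so that both describe [Gam]. *)
  apply: (is_Gamma_unique oddT GamT).
  by apply: is_Gamma_transport iso GamT'; case: GamT.
subst T'; case: oddT => subT _ betaP.
exact: (Gamma_iso_of_Xi subT betaP eq_beta GamT GamT' Xi_g).
Qed.
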